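(* Let $\{w_k\}_{k\ge 0}=\{(x_k,y_k)\}_{k\ge 0}\subseteq\mathcal F^\circ\times\mathbb R^m_{++}$ and $\{\mu_k\}_{k\ge 0}\subset(0,\infty)$ with $\lim_{k\to\infty}\mu_k=0$ be sequences generated by the second-order version of the outer iteration, i.e. for every $k\ge0$ $$\|\operatorname{grad}_x\mathcal L(w_{k+1})\|_{x_{k+1}}\le\varphi_1(\mu_k),\quad \|Y_{k+1}g(x_{k+1})-\mu_k\mathbf 1\|\le\varphi_2(\mu_k),\quad \lambda_{\min}[H(w_{k+1})]\ge-\varphi_3(\mu_k),\quad g(x_{k+1})>0,\ y_{k+1}>0 .$$ Let $x^*\in\mathcal F$ be an accumulation point of $\{x_k\}$ and $\{x_{k_n}\}_n$ a subsequence converging to $x^*$. Suppose that: - $\{\|\operatorname{grad}g_i(x_{k_n})\|_{x_{k_n}}\}_n$ is bounded for every $i$; - $\{\operatorname{grad}g_i(x^* )\}_{i\in\mathcal A(x^* )}$ is linearly independent in $T_{x^*}\mathcal M$; - for each $\phi\in\{f,g_1,\dots,g_m\}$ there are $C_\phi>0$ and a closed neighborhood $\mathcal V_\phi$ of $x^*$ such that $\|\operatorname{Hess}\phi(x^* )-P_{x^*\leftarrow x}\circ\operatorname{Hess}\phi(x)\circ P_{x\leftarrow x^*}\|_{\rm op}\le C_\phi\operatorname{dist}(x,x^* )$ for all $x\in\mathcal V_\phi$; - the strict complementarity condition holds at $x^*$ with its associated Lagrange multiplier vector $y^*$: for each $i\in\mathcal I$ exactly one of $y_i^*$ and $g_i(x^*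 )$ is zero. Then $(x^*,y^* )$ is a second-order stationary point of the problem.
   Context: $\mathcal M$ is a finite-dimensional, connected, complete Riemannian manifold with metric $\langle\cdot,\cdot\rangle_x$, norm $\|\cdot\|_x$ and Riemannian distance $\operatorname{dist}$; $f,g_1,\dots,g_m:\mathcal M\to\mathbb R$ are $C^2$. The problem is: minimize $f(x)$ over $x\in\mathcal M$ subject to $g_i(x)\ge0$, $i\in\mathcal I=\{1,\dots,m\}$. $g=(g_1,\dots,g_m)$; $\mathcal F=\{x: g_i(x)\ge0\ \forall i\}$, $\mathcal F^\circ=\{x: g_i(x)>0\ \forall i\}$, $\mathcal A(x)=\{i: g_i(x)=0\}$. $\operatorname{grad}$, $\operatorname{Hess}$ are the Riemannian gradient and Hessian (Levi-Civita connection). For $w=(x,y)\in\mathcal M\times\mathbb R^m$: $\mathcal L(w)=f(x)-\sum_i y_ig_i(x)$, $\operatorname{grad}_x\mathcal L(w)=\operatorname{grad}f(x)-\sum_iy_i\operatorname{grad}g_i(x)$, $\operatorname{Hess}_x\mathcal L(w)=\operatorname{Hess}f(x)-\sum_iy_i\operatorname{Hess}g_i(x)$. For $x\in\mathcal F^\circ$, $H(w):T_x\mathcal M\to T_x\mathcal M$ is $H(w)[\xi]=\operatorname{Hess}_x\mathcal L(w)[\xi]+\sum_i\frac{y_i}{g_i(x)}\langle\operatorname{grad}g_i(x),\xi\rangle_x\operatorname{grad}g_i(x)$, and $\lambda_{\min}[\cdot]$ is the minimum eigenvalue. $Y_k=\operatorname{diag}(y_k)$, $\mathbf 1$ is the all-ones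 vector, $\|\cdot\|_{\rm op}$ the operator norm. $\varphi_1,\varphi_2,\varphi_3:[0,\infty)\to[0,\infty)$ are fixed forcing functions: continuous, with $\varphi_j(\mu)=0$ iff $\mu=0$. The outer iteration starts from $w_0\in\mathcal F^\circ\times\mathbb R^m_{++}$ and at each $k$ picks $\mu_k>0$ and any $w_{k+1}\in\mathcal F^\circ\times\mathbb R^m_{++}$ satisfying the stopping conditions displayed in the claim. $P_{x_2\leftarrow x_1}:T_{x_1}\mathcal M\to T_{x_2}\mathcal M$ is parallel transport along the unique minimizing geodesic joining $x_1$ and $x_2$, for $x_2$ sufficiently close to $x_1$ (neighborhoods are understood small enough for this). $x^*$ is a KKT point with Lagrange multiplier vector $y^*$ if $\operatorname{grad}_x\mathcal L(x^*,y^* )=0$, and $y^*_i\ge0$, $g_i(x^* )\ge0$, $y_i^*g_i(x^* )=0$ for all $i$. (Under the hypotheses $x^*$ is a KKT point, and by linear independence $y^*$ is unique.) $(x^*,y^* )$ is a second-order stationary point if $x^*$ is a KKT point with multiplier $y^*$ and $\langle\operatorname{Hess}_x\mathcal L(x^*,y^* )[\xi],\xi\rangle_{x^*}\ge0$ for all $\xi$ in the critical cone, i.e. all $\xi\in T_{x^*}\mathcal M$ with $\langle\operatorname{grad}g_i(x^* ),\xi\rangle_{x^*}=0$ for $i\in\mathcal A(x^* )$ with $y_i^*>0$ and $\langle\operatorname{grad}g_i(x^* ),\xi\rangle_{x^*}\ge0$ for $i\in\mathcal A(x^* )$ with $y_i^*=0$. *)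

(* Defs.v *)
From HB Require Import structures.
From mathcomp Require Import all_boot all_order all_algebra.
From mathcomp Require Import all_classical all_reals all_analysis.

Set Implicit Arguments.
Unset Strict Implicit.
Unset Printing Implicit Defensive.

Import Order.TTheory GRing.Theory Num.Theory.
Import numFieldNormedType.Exports.

Local Open Scope classical_set_scope.
Local Open Scope ring_scope.

(* MathComp / MathComp-Analysis development.

   MathComp-Analysis has no manifolds.  Riemannian manifolds are set up below
   with a distinguished chart [chart_at x] around each point: a tangent vector
   at x is the row vector of its coordinates in the coordinate basis of
   [chart_at x], so T_x M is 'rV[R]_n and operators on T_x M are functions
   'rV[R]_n -> 'rV[R]_n.  [tcoord] changes coordinates between charts. *)

Section EuclideanCalculus.
Context {R : realType} {n : nat}.
Implicit Types (U : set 'rV[R]_n) (h : 'rV[R]_n -> R).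

Definition pderiv (i : 'I_n) h (u : 'rV[R]_n) : R := 'D_(delta_mx 0 i) h u.

(* For U open: h is C^0 on U if it is continuous there, and C^(k+1) if it is
   differentiable with partial derivatives of class C^k. *)
Fixpoint Ck_on (k : nat) U h : Prop :=
  match k with
  | 0%N => forall u, U u -> {for u, continuous h}
  | k'.+1 => (forall u, U u -> differentiable h u) /\
             (forall i, Ck_on k' U (pderiv i h))
  end.

Definition smooth_on U h := forall k, Ck_on k U h.

Definition enorm (v : 'rV[R]_n) : R := Num.sqrt (\sum_i v 0 i ^+ 2).

(* Minimum eigenvalue; the inf is over a finite set, which for the self-adjoint
   operators considered here is empty only when n = 0 (and then the value is
   inf set0 = 0). *)
Definition lambda_min (A : 'rV[R]_n -> 'rV[R]_n) : R :=
  inf [set a | eigenvalue (lin1_mx A) a].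

End EuclideanCalculus.

Record chart (R : realType) (n : nat) (M : topologicalType) := Chart {
  csrc : set M;
  ctgt : set 'rV[R]_n;
  cfwd : M -> 'rV[R]_n;
  cinv : 'rV[R]_n -> M;
  csrc_open : open csrc;
  ctgt_open : open ctgt;
  cfwd_tgt : forall x, csrc x -> ctgt (cfwd x);
  cinv_src : forall u, ctgt u -> csrc (cinv u);
  cfwdK : forall x, csrc x -> cinv (cfwd x) = x;
  cinvK : forall u, ctgt u -> cfwd (cinv u) = u;
  cfwd_cont : forall x, csrc x -> {for x, continuous cfwd};
  cinv_cont : forall u, ctgt u -> {for u, continuous cinv} }.

Record smoothManifold (R : realType) (n : nat) := SmoothManifold {
  msort :> topologicalType;
  atlas : set (chart R n msort);
  chart_at : msort -> chart R n msort;
  man_hausdorff : hausdorff_space msort;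
  man_second_countable : @second_countable msort;
  chart_at_atlas : forall x, atlas (chart_at x);
  chart_at_src : forall x, csrc (chart_at x) x;
  transition_smooth : forall c d, atlas c -> atlas d -> forall j : 'I_n,
    smooth_on (ctgt c `&` cinv c @^-1` csrc d)
              (fun u => cfwd d (cinv c u) 0 j) }.

Section TangentVectors.
Context {R : realType} {n : nat} {M : smoothManifold R n}.

(* Coordinates in the chart d of the tangent vector at x whose coordinates in
   the chart c are xi. *)
Definition tcoord (c d : chart R n M) (x : M) (xi : 'rV[R]_n) : 'rV[R]_n :=
  'D_xi (cfwd d \o cinv c) (cfwd c x).

Definition manCk (k : nat) (f : M -> R) :=
  forall c : chart R n M, atlas c -> Ck_on k (ctgt c) (f \o cinv c).

(* Gram matrix, in the coordinate basis of c and as a function of the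
   coordinates, of a field G of bilinear forms (G x being the Gram matrix in
   the coordinate basis of [chart_at x]). *)
Definition chart_gram (G : M -> 'M[R]_n) (c : chart R n M) (u : 'rV[R]_n)
    : 'M[R]_n :=
  let x := cinv c u in
  let e i := tcoord c (chart_at x) x (delta_mx 0 i) in
  \matrix_(i, j) (e i *m G x *m (e j)^T) 0 0.

End TangentVectors.

Record riemannianManifold (R : realType) (n : nat) := RiemannianManifold {
  rman :> smoothManifold R n;
  metric : rman -> 'M[R]_n;
  metric_sym : forall x, (metric x)^T = metric x;
  metric_pos : forall x (xi : 'rV[R]_n), xi != 0 ->
    0 < (xi *m metric x *m xi^T) 0 0;
  metric_smooth : forall c, atlas c -> forall i j,
    smooth_on (ctgt c) (fun u => chart_gram metric c u i j) }.

Section RiemannianGeometry.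
Context {R : realType} {n : nat} {M : riemannianManifold R n}.
Implicit Types (x y : M) (c : chart R n M) (u xi eta : 'rV[R]_n).
Implicit Types (f : M -> R) (gam : R -> M) (V : R -> 'rV[R]_n) (a b t : R).

Definition inner x xi eta : R := (xi *m metric x *m eta^T) 0 0.
Definition rnorm x xi : R := Num.sqrt (inner x xi xi).

Definition gram c u : 'M[R]_n := chart_gram (@metric R n M) c u.

(* Gamma_c(xi, eta)^k = sum_(i,j) Gamma^k_ij xi^i eta^j, with Gamma^k_ij the
   Christoffel symbols of the Levi-Civita connection. *)
Definition christoffel c u xi eta : 'rV[R]_n :=
  \row_k \sum_i \sum_j xi 0 i * eta 0 j *
    (2^-1 * \sum_l invmx (gram c u) k l *
      (pderiv i (fun v => gram c v j l) u
       + pderiv j (fun v => gram c v i l) u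
       - pderiv l (fun v => gram c v i j) u)).

(* The gradient field in the chart c: <grad f, xi> = df(xi) reads
   (grad f)^k = sum_i g^{ki} d_i f. *)
Definition chart_grad f c u : 'rV[R]_n :=
  (\row_i pderiv i (f \o cinv c) u) *m invmx (gram c u).

Definition grad f x : 'rV[R]_n :=
  let c := chart_at x in chart_grad f c (cfwd c x).

(* Hess f(x)[xi] is the covariant derivative of grad f along xi. *)
Definition hess f x xi : 'rV[R]_n :=
  let c := chart_at x in let u := cfwd c x in
  'D_xi (chart_grad f c) u + christoffel c u xi (chart_grad f c u).

Definition op_norm x (A : 'rV[R]_n -> 'rV[R]_n) : R :=
  sup [set rnorm x (A xi) | xi in [set xi | rnorm x xi <= 1]].

(* The pointwise property P holds on an open neighbourhood of [a, b]. *)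
Definition near_itv a b (P : R -> Prop) :=
  forall t, a <= t <= b -> \forall s \near t, P s.

Definition C1_at gam t :=
  {for t, continuous gam} /\
  forall c, atlas c -> csrc c (gam t) ->
    derivable (cfwd c \o gam) t 1 /\
    {for t, continuous (derive1 (cfwd c \o gam))}.

Definition velocity gam t : 'rV[R]_n :=
  derive1 (cfwd (chart_at (gam t)) \o gam) t.

Definition arc_length gam a b : R :=
  \int[lebesgue_measure]_(t in `[a, b]) rnorm (gam t) (velocity gam t).

(* There is a piecewise C^1 path of length L from x to y. *)
Inductive joined_by_path : M -> M -> R -> Prop :=
| path_C1 gam a b : a <= b -> near_itv a b (C1_at gam) ->
    joined_by_path (gam a) (gam b) (arc_length gam a b)
| path_cat x y z L L' : joined_by_path x y L -> joined_by_path y z L' ->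
    joined_by_path x z (L + L').

Definition rdist x y : R := inf [set L | joined_by_path x y L].

Definition metrically_complete :=
  forall p : nat -> M,
    (forall e : R, 0 < e -> exists N : nat, forall i j : nat,
       (N <= i)%N -> (N <= j)%N -> rdist (p i) (p j) < e) ->
    exists x, (fun i => rdist (p i) x) @ \oo --> (0 : R).

(* A vector field V along gam, V s being an element of T_(gam s) M, read in the
   chart c. *)
Definition field_in_chart c gam V (s : R) : 'rV[R]_n :=
  tcoord (chart_at (gam s)) c (gam s) (V s).

Definition cov_deriv gam V t : 'rV[R]_n :=
  let c := chart_at (gam t) in
  derive1 (field_in_chart c gam V) t
  + christoffel c (cfwd c (gam t)) (velocity gam t) (V t).

Definition parallel_at gam V t :=
  derivable (field_in_chart (chart_at (gam t)) gam V) t 1 /\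
  cov_deriv gam V t = 0.

Definition geodesic gam a b :=
  near_itv a b (fun t => C1_at gam t /\ parallel_at gam (velocity gam) t).

Definition min_geodesic x y gam :=
  [/\ geodesic gam 0 1, gam 0 = x, gam 1 = y
    & arc_length gam 0 1 = rdist x y].

Definition unique_min_geodesic x y :=
  (exists gam, min_geodesic x y gam) /\
  (forall gam gam', min_geodesic x y gam -> min_geodesic x y gam' ->
     forall t, 0 <= t <= 1 -> gam t = gam' t).

(* [ptransport x1 x2] is P_(x2 <- x1); it is meaningful when
   [unique_min_geodesic x1 x2] holds. *)
Definition ptransport x1 x2 xi : 'rV[R]_n :=
  xget 0 [set eta | exists gam V,
    [/\ min_geodesic x1 x2 gam, near_itv 0 1 (parallel_at gam V),
        V 0 = xi & V 1 = eta]].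

(* The neighbourhood is small enough for parallel transport to be defined. *)
Definition locally_lipschitz_hess f x0 :=
  exists (C : R) (W : set M),
    [/\ 0 < C, closed W, nbhs x0 W,
        forall x, W x -> unique_min_geodesic x0 x /\ unique_min_geodesic x x0
      & forall x, W x ->
        op_norm x0 (fun xi =>
          hess f x0 xi - ptransport x x0 (hess f x (ptransport x0 x xi)))
        <= C * rdist x x0].

End RiemannianGeometry.

Arguments metrically_complete {R n} M.

Definition forcing_function (R : realType) (phi : R -> R) :=
  [/\ {within `[0, +oo[, continuous phi},
      forall mu, 0 <= mu -> 0 <= phi mu
    & forall mu, 0 <= mu -> (phi mu = 0 <-> mu = 0)].

Section Optimization.
Context {R : realType} {n m : nat} {M : riemannianManifold R n}.
Variables (f : M -> R) (g : 'I_m -> M -> R).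
Implicit Types (x : M) (y : 'rV[R]_m) (xi : 'rV[R]_n).

Definition feasible x := forall i, 0 <= g i x.
Definition strictly_feasible x := forall i, 0 < g i x.
Definition active x (i : 'I_m) := g i x == 0.

Definition grad_L x y : 'rV[R]_n :=
  grad f x - \sum_i y 0 i *: grad (g i) x.

Definition hess_L x y xi : 'rV[R]_n :=
  hess f x xi - \sum_i y 0 i *: hess (g i) x xi.

Definition H_op x y xi : 'rV[R]_n :=
  hess_L x y xi
  + \sum_i (y 0 i / g i x * inner x (grad (g i) x) xi) *: grad (g i) x.

(* Y g(x) - mu 1, as a row vector. *)
Definition compl_residual x y (mu : R) : 'rV[R]_m :=
  (\row_i g i x) *m diag_mx y - const_mx mu.

Definition stopping_conditions (phi1 phi2 phi3 : R -> R) (mu : R) x y :=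
  [/\ rnorm x (grad_L x y) <= phi1 mu,
      enorm (compl_residual x y mu) <= phi2 mu,
      - phi3 mu <= lambda_min (H_op x y),
      strictly_feasible x
    & forall i, 0 < y 0 i].

Definition active_grads_free x :=
  forall a : 'I_m -> R, \sum_(i | active x i) a i *: grad (g i) x = 0 ->
    forall i, active x i -> a i = 0.

Definition is_KKT x y :=
  grad_L x y = 0 /\
  forall i, [/\ 0 <= y 0 i, 0 <= g i x & y 0 i * g i x = 0].

Definition critical_cone x y : set 'rV[R]_n :=
  [set xi | forall i, active x i ->
     (0 < y 0 i -> inner x (grad (g i) x) xi = 0) /\
     (y 0 i = 0 -> 0 <= inner x (grad (g i) x) xi)].

Definition is_SOSP x y :=
  is_KKT x y /\
  forall xi, critical_cone x y xi -> 0 <= inner x (hess_L x y xi) xi.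

Definition strict_complementarity x y :=
  forall i, (y 0 i == 0) (+) (g i x == 0).

End Optimization.

(* Main.v *)
(* Everything is read in the fixed chart c around x*, so no parallel transport is
   needed.  There the Hessian quadratic form is
     <Hess F xi, xi> = D_xi D_xi F - (D_xi G)(X, xi) + (D_X G)(xi, xi) / 2
   with G the Gram matrix and X the gradient; by the symmetry of the second
   derivatives of the transition maps it does not depend on the chart, so it
   converges along x_k -> x* by the C^2 hypotheses.  The multipliers of the
   inactive constraints tend to 0, and those of the active ones solve a Gram
   system which is invertible in the limit by linear independence; hence y_k
   converges, to a KKT multiplier.  A vector xi tangent to the active constraints
   at x* is approximated by xi_k tangent to them at x_k; the lower bound on the
   least eigenvalue of H gives <H xi_k, xi_k> >= - phi_3 |xi_k|^2, in which the
   active barrier terms vanish and the inactive ones tend to 0. *)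

Require Import Defs.
From HB Require Import structures.
From mathcomp Require Import all_boot all_order all_algebra.
From mathcomp Require Import all_classical all_reals all_analysis.
From mathcomp Require Import ring.

Set Implicit Arguments.
Unset Strict Implicit.
Unset Printing Implicit Defensive.

Import Order.TTheory GRing.Theory Num.Theory.
Import numFieldNormedType.Exports.

Local Open Scope classical_set_scope.
Local Open Scope ring_scope.

(** * Calculus of matrix-valued functions *)

Section MatrixCalculus.
Context {R : realType} {V : normedModType R}.

(** [chart_at x] may vary with [x] without any continuity, so the coordinate rows of [grad f] and
    [hess f] along the iterates need not converge, even for smooth [f]. Only scalars are passed to
    the limit: each inner product at an iterate is rewritten, through the Jacobian of a transition
    map, in terms of partial derivatives in the fixed chart. The weight y_i / g_i of an active
    constraint diverges when its limit multiplier is positive, and no rate relates it to the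
    distance from x_k to x*. A direction that is merely asymptotically tangent would thus leave an
    uncontrolled barrier term, which is why xi_k is made exactly orthogonal to the active gradients.
    The Gram system that determines the multipliers also supplies the coefficients of this
    correction. The limit gives nonnegativity on the common kernel of the active gradients. Strict
    complementarity makes every active multiplier positive, so that the critical cone is this
    kernel. *)

Lemma differentiable_mx (p q : nat) (A : V -> 'M[R]_(p, q)) t :
  (forall i j, differentiable (fun w => A w i j) t) -> differentiable A t.
Proof.
move=> dA.
have -> : A = \sum_i \sum_j (fun w => A w i j *: (delta_mx i j : 'M[R]_(p, q))).
  apply/funext => w; rewrite [LHS]matrix_sum_delta fct_sumE.
  by apply: eq_bigr => i _; rewrite fct_sumE.
by do 2 apply: differentiable_sum => ?; exact: differentiableZl.
Qed.

Lemma differentiable_entry (p q : nat) (A : V -> 'M[R]_(p, q)) t i j :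
  differentiable A t -> differentiable (fun w => A w i j) t.
Proof.
move=> dA; apply: (@differentiable_comp _ _ _ _ A (fun B : 'M[R]_(p, q) => B i j)) => //.
exact: differentiable_coord.
Qed.

Lemma is_derive_mxP (p q : nat) (A : V -> 'M[R]_(p, q)) t v dA :
  is_derive t v A dA <-> forall i j, is_derive t v (fun w => A w i j) (dA i j).
Proof.
split=> [[dA1 <-] i j|dA1].
  by rewrite derive_mx// mxE; apply: DeriveDef => //; exact: (derivable_mxP _ _ _).1.
have H : derivable A t v by apply/derivable_mxP => i j; have [] := dA1 i j.
apply: DeriveDef => //; rewrite derive_mx//; apply/matrixP => i j.
by rewrite mxE; have [] := dA1 i j.
Qed.

Lemma is_derive_mulmx (p q r : nat) (A : V -> 'M[R]_(p, q)) (B : V -> 'M[R]_(q, r))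
    t v dA dB :
  is_derive t v A dA -> is_derive t v B dB ->
  is_derive t v (fun w => A w *m B w) (dA *m B t + A t *m dB).
Proof.
move=> /is_derive_mxP hA /is_derive_mxP hB; apply/is_derive_mxP => i j.
have -> : (fun w => (A w *m B w) i j) =
    \sum_k ((fun w => A w i k) * (fun w => B w k j)).
  by apply/funext => w; rewrite mxE fct_sumE.
have hk k : is_derive t v ((fun w => A w i k) * (fun w => B w k j))
    (A t i k *: dB k j + B t k j *: dA i k).
  by have := hA i k; have := hB k j => ? ?; apply: is_deriveM.
apply: is_derive_eq (is_derive_sum hk) _.
rewrite !mxE -big_split/=; apply: eq_bigr => k _.
by rewrite /GRing.scale/= addrC; congr (_ + _); rewrite mulrC.
Qed.

Lemma is_derive_trmx (p q : nat) (A : V -> 'M[R]_(p, q)) t v dA :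
  is_derive t v A dA -> is_derive t v (fun w => (A w)^T) dA^T.
Proof.
move=> /is_derive_mxP hA; apply/is_derive_mxP => i j; rewrite mxE.
rewrite (_ : (fun w => _) = (fun w => A w j i))//; apply/funext => w.
by rewrite mxE.
Qed.

Lemma differentiable_mulmx (p q r : nat) (A : V -> 'M[R]_(p, q))
    (B : V -> 'M[R]_(q, r)) t :
  differentiable A t -> differentiable B t ->
  differentiable (fun w => A w *m B w) t.
Proof.
move=> dA dB; apply: differentiable_mx => i j.
have -> : (fun w => (A w *m B w) i j) =
    \sum_k ((fun w => A w i k) * (fun w => B w k j)).
  by apply/funext => w; rewrite mxE fct_sumE.
by apply: differentiable_sum => k; apply: differentiableM; exact: differentiable_entry.
Qed.

Lemma differentiable_prod (I : Type) (s : seq I) (F : I -> V -> R) t :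
  (forall i, differentiable (F i) t) ->
  differentiable (fun w => \prod_(i <- s) F i w) t.
Proof.
move=> dF; elim: s => [|i s IHs].
  rewrite (_ : (fun _ => _) = cst 1); first exact: differentiable_cst.
  by apply/funext => w; rewrite big_nil.
rewrite (_ : (fun _ => _) = F i * (fun w => \prod_(i <- s) F i w)); last first.
  by apply/funext => w; rewrite big_cons.
exact: differentiableM.
Qed.

Lemma differentiable_bigsum (I : Type) (s : seq I) (F : I -> V -> R) t :
  (forall i, differentiable (F i) t) ->
  differentiable (fun w => \sum_(i <- s) F i w) t.
Proof.
move=> dF; elim: s => [|i s IHs].
  rewrite (_ : (fun _ => _) = cst 0); first exact: differentiable_cst.
  by apply/funext => w; rewrite big_nil.
rewrite (_ : (fun _ => _) = F i + (fun w => \sum_(i <- s) F i w)); last first.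
  by apply/funext => w; rewrite big_cons.
exact: differentiableD.
Qed.

Lemma differentiable_det (p : nat) (A : V -> 'M[R]_p) t :
  differentiable A t -> differentiable (fun w => \det (A w)) t.
Proof.
move=> dA; rewrite /determinant; apply: differentiable_bigsum => s.
apply: differentiableM; first exact: differentiable_cst.
by apply: differentiable_prod => i; exact: differentiable_entry.
Qed.

(* The adjugate quotient is [invmx (A w)] wherever [A w] is invertible, hence near t. *)
Lemma differentiable_adj_det (p : nat) (A : V -> 'M[R]_p) t :
  differentiable A t -> A t \in unitmx ->
  differentiable (fun w => (\det (A w))^-1 *: \adj (A w)) t.
Proof.
move=> dA uA; apply: differentiable_mx => i j.
have -> : (fun w => ((\det (A w))^-1 *: \adj (A w)) i j) =
    (fun w => (\det (A w))^-1) * (fun w => (\adj (A w)) i j).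
  by apply/funext => w; rewrite mxE.
apply: differentiableM.
  apply: differentiableV; first exact: differentiable_det.
  by rewrite -unitfE -unitmxE.
rewrite (_ : (fun _ => _) =
   cst ((-1) ^+ (j + i)) * (fun w => \det (row' j (col' i (A w))))); last first.
  by apply/funext => w; rewrite mxE.
apply: differentiableM; first exact: differentiable_cst.
apply: differentiable_det; apply: differentiable_mx => k l.
rewrite (_ : (fun _ => _) = fun w => A w (lift j k) (lift i l)).
  exact: differentiable_entry.
by apply/funext => w; rewrite !mxE.
Qed.

Lemma near_unitmx (p : nat) (A : V -> 'M[R]_p) t :
  differentiable A t -> A t \in unitmx -> \forall w \near t, A w \in unitmx.
Proof.
move=> dA uA.
have cd : (fun w => \det (A w)) @ t --> \det (A t).
  exact: differentiable_continuous (differentiable_det dA).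
have : \forall w \near t, \det (A w) != 0.
  by apply: cvgr_neq0 cd _; rewrite -unitfE -unitmxE.
by apply: filterS => w; rewrite unitmxE unitfE.
Qed.

Lemma near_invmxE (p : nat) (A : V -> 'M[R]_p) t :
  differentiable A t -> A t \in unitmx ->
  \forall w \near t, (\det (A w))^-1 *: \adj (A w) = invmx (A w).
Proof.
move=> dA uA; have := near_unitmx dA uA.
by apply: filterS => w uw; rewrite /invmx uw.
Qed.

End MatrixCalculus.

(** * Directional derivatives and the symmetry of second derivatives *)

Section Derivatives.
Context {R : realType}.

Lemma derive_comp (U V W : normedModType R) (f : U -> V) (h : V -> W) t v :
  differentiable f t -> differentiable h (f t) ->
  is_derive t v (h \o f) ('D_('D_v f t) h (f t)).
Proof.
move=> df dh; apply: DeriveDef.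
  by apply: diff_derivable; exact: differentiable_comp.
rewrite deriveE; last exact: differentiable_comp.
by rewrite (diff_comp df dh)/= -(deriveE v df) -(deriveE ('D_v f t) dh).
Qed.

Lemma deriveDv (V W : normedModType R) (h : V -> W) t v w :
  differentiable h t -> 'D_(v + w) h t = 'D_v h t + 'D_w h t.
Proof. by move=> dh; rewrite !(deriveE _ dh) linearD. Qed.

Lemma deriveZv (V W : normedModType R) (h : V -> W) t a v :
  differentiable h t -> 'D_(a *: v) h t = a *: 'D_v h t.
Proof. by move=> dh; rewrite !(deriveE _ dh) linearZ. Qed.

Lemma derive_pderiv n (h : 'rV[R]_n -> R) t v :
  differentiable h t -> 'D_v h t = \sum_i v 0 i * pderiv i h t.
Proof.
move=> dh; rewrite (deriveE _ dh) {1}(row_sum_delta v) linear_sum.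
by apply: eq_bigr => i _; rewrite linearZ /pderiv (deriveE _ dh).
Qed.

Lemma is_derive_line (V : normedModType R) (h : V -> R) p v (a : R) :
  differentiable h (p + a *: v) ->
  is_derive a 1 (fun b => h (p + b *: v)) ('D_v h (p + a *: v)).
Proof.
move=> dh.
have ds : is_derive a (1 : R) (fun b : R => p + b *: v) v.
  have dz : is_diff a ( *:%R ^~ v : R -> V) ( *:%R ^~ v) by exact: is_diff_scalel.
  have d1 : is_derive a 1 ( *:%R ^~ v : R -> V) v.
    apply: DeriveDef; first exact/diff_derivable.
    by rewrite deriveE// diff_val scale1r.
  by have := is_deriveD (is_derive_cst p a 1) d1; rewrite add0r.
have df : differentiable (fun b : R => p + b *: v) a.
  by apply/derivable1_diffP; have [] := ds.
have := derive_comp (1 : R) df dh.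
by rewrite derive_val.
Qed.

(** The mean value theorem is applied twice: along [v] to the increment of [h] in direction [w],
    then along [w] to ['D_v h]. The differentiability assumptions cover the whole parallelogram
    because the intermediate points are not known in advance. *)
Lemma second_difference (V : normedModType R) (h : V -> R) u v w (s : R) :
  0 < s ->
  (forall a b, 0 <= a <= s -> 0 <= b <= s ->
     differentiable h (u + a *: v + b *: w) /\
     differentiable ('D_v h) (u + a *: v + b *: w)) ->
  exists a b, [/\ 0 <= a <= s, 0 <= b <= s &
    h (u + s *: v + s *: w) - h (u + s *: v) - h (u + s *: w) + h u =
    s * s * 'D_w ('D_v h) (u + a *: v + b *: w)].
Proof.
move=> s0 dh.
have dh0 a : 0 <= a <= s -> differentiable h (u + a *: v).
  move=> ha; have [|+ _] := dh a 0 ha; first by rewrite lexx ltW.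
  by rewrite scale0r addr0.
pose k (a : R) := h (u + s *: w + a *: v) - h (u + a *: v).
have ks : 0 <= s <= s by rewrite lexx ltW.
have dk a : 0 <= a <= s ->
    is_derive a 1 k ('D_v h (u + s *: w + a *: v) - 'D_v h (u + a *: v)).
  move=> ha; have d1 := is_derive_line (dh0 _ ha).
  have /is_derive_line d2 : differentiable h (u + s *: w + a *: v).
    by rewrite addrAC; have [] := dh _ _ ha ks.
  exact: is_deriveB.
have [a||a /[!in_itv]/= /andP[a0 as_] ka] := @MVT _ k (fun a =>
   'D_v h (u + s *: w + a *: v) - 'D_v h (u + a *: v)) 0 s s0.
- by rewrite in_itv/= => /andP[a0 as_]; apply: dk; rewrite !ltW.
- apply: derivable_within_continuous => a; rewrite in_itv/= => ha.
  by have [] := dk _ ha.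
have ha : 0 <= a <= s by rewrite !ltW.
have dl b : 0 <= b <= s -> is_derive b 1 (fun b => 'D_v h (u + a *: v + b *: w))
    ('D_w ('D_v h) (u + a *: v + b *: w)).
  by move=> hb; apply: is_derive_line; have [] := dh _ _ ha hb.
have [b||b /[!in_itv]/= /andP[b0 bs] kb] := @MVT _
  (fun b => 'D_v h (u + a *: v + b *: w))
  (fun b => 'D_w ('D_v h) (u + a *: v + b *: w)) 0 s s0.
- by rewrite in_itv/= => /andP[b0 bs]; apply: dl; rewrite !ltW.
- apply: derivable_within_continuous => b; rewrite in_itv/= => hb.
  by have [] := dl _ hb.
exists a, b; split; rewrite ?(ltW a0, ltW as_, ltW b0, ltW bs)//.
move: ka kb; rewrite /k !subr0 !scale0r !addr0 (addrAC u (s *: w) (a *: v)).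
rewrite (addrAC u (s *: w) (s *: v)) => + kb; rewrite kb.
by move=> ka; rewrite (mulrC (s * s)) mulrA -ka; ring.
Qed.

(** Schwarz's theorem: the second difference is symmetric in [v] and [w], so [second_difference]
    used in both orders yields one common value of the two mixed derivatives, taken at two points
    near [u]. Continuity brings each derivative at [u] within e / 2 of that value. *)
Lemma derive_commute (V : normedModType R) (h : V -> R) u v w :
  (\forall p \near u, [/\ differentiable h p, differentiable ('D_v h) p
                        & differentiable ('D_w h) p]) ->
  {for u, continuous ('D_w ('D_v h))} -> {for u, continuous ('D_v ('D_w h))} ->
  'D_w ('D_v h) u = 'D_v ('D_w h) u.
Proof.
move=> dh cwv cvw; apply/eqP; rewrite -subr_eq0 -normr_le0.
apply/ler_addgt0Pr => e e0; rewrite add0r (splitr e).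
have e20 : 0 < e / 2 by rewrite divr_gt0.
move/cvgrPdist_le/(_ _ e20) : cwv => cwv; move/cvgrPdist_le/(_ _ e20) : cvw => cvw.
move: dh cwv cvw => /nbhs_ballP[d1 /= d10 H1] /nbhs_ballP[d2 /= d20 H2].
move=> /nbhs_ballP[d3 /= d30 H3].
pose d := Num.min d1 (Num.min d2 d3).
have d0 : 0 < d by rewrite !lt_min d10 d20.
have Hd1 p : ball u d p -> ball u d1 p.
  by apply: le_ball; rewrite ge_min lexx.
have Hd2 p : ball u d p -> ball u d2 p.
  by apply: le_ball; rewrite !ge_min lexx orbT.
have Hd3 p : ball u d p -> ball u d3 p.
  by apply: le_ball; rewrite !ge_min lexx !orbT.
pose r := `|v| + `|w| + 1.
have r0 : 0 < r by rewrite ltr_wpDl// addr_ge0.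
(* With this [s] the parallelogram stays within s * r = d / 2 of [u]; the summand 1 keeps [r]
   positive when [v] and [w] both vanish. *)
pose s := d / (2 * r).
have s0 : 0 < s by rewrite divr_gt0// mulr_gt0.
have inb a b : 0 <= a <= s -> 0 <= b <= s -> ball u d (u + a *: v + b *: w).
  move=> /andP[a0 as_] /andP[b0 bs].
  rewrite -ball_normE/= -addrA opprD addNKr normrN.
  rewrite (le_lt_trans (ler_normD _ _))// !normrZ !ger0_norm//.
  apply: (@le_lt_trans _ _ (s * r)).
    rewrite /r !mulrDr mulr1 -[leLHS]addr0 lerD// ?(ltW s0)//.
    by rewrite lerD// ler_wpM2r.
  rewrite /s invfM mulrA mulfVK ?gt_eqF//.
  by rewrite ltr_pdivrMr// ltr_pMr// ltr1n.
have inb' a b : 0 <= a <= s -> 0 <= b <= s -> ball u d (u + a *: w + b *: v).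
  by move=> ha hb; rewrite addrAC; exact: inb.
have [|a [b [ha hb E1]]] := @second_difference V h u v w s s0.
  by move=> a b ha hb; have [] := H1 _ (Hd1 _ (inb _ _ ha hb)).
have [|a' [b' [ha' hb' E2]]] := @second_difference V h u w v s s0.
  by move=> a' b' ha' hb'; have [] := H1 _ (Hd1 _ (inb' _ _ ha' hb')).
have E : 'D_w ('D_v h) (u + a *: v + b *: w) = 'D_v ('D_w h) (u + a' *: w + b' *: v).
  apply: (@mulfI _ (s * s)); first by rewrite mulf_neq0 ?gt_eqF.
  apply: etrans (esym E1) _; apply: etrans _ E2.
  rewrite (addrAC u (s *: w) (s *: v)); congr (_ + _).
  by rewrite -[LHS]addrA -[RHS]addrA; congr (_ + _); rewrite addrC.
have /= h2 := H2 _ (Hd2 _ (inb _ _ ha hb)).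
have /= h3 := H3 _ (Hd3 _ (inb' _ _ ha' hb')).
rewrite -E in h3.
apply: le_trans (ler_distD ('D_w ('D_v h) (u + a *: v + b *: w)) _ _) _.
by apply: lerD; [exact: h2 | rewrite distrC; exact: h3].
Qed.

End Derivatives.

(** * The Hessian quadratic form in coordinates *)

(* Unfolding [derive] makes unification diverge in the rewrites below. *)
#[local] Opaque derive.

Section LocalForm.
Context {R : realType} {n : nat}.
Implicit Types (U : set 'rV[R]_n) (h F : 'rV[R]_n -> R) (G : 'rV[R]_n -> 'M[R]_n).
Implicit Types (A : 'M[R]_n) (a b u v w xi X : 'rV[R]_n).

Definition bil A a b : R := (a *m A *m b^T) 0 0.

Lemma dot_rVC a b : (a *m b^T) 0 0 = (b *m a^T) 0 0.
Proof. by rewrite !mxE; apply: eq_bigr => i _; rewrite !mxE mulrC. Qed.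

Lemma bilC A a b : A^T = A -> bil A a b = bil A b a.
Proof.
move=> sA; rewrite /bil -[LHS]/((a *m A *m b^T) 0 0) -[in LHS](trmxK (_ *m _)) mxE.
by rewrite !trmx_mul trmxK sA mulmxA.
Qed.

Lemma bilDl A a b v : bil A (a + b) v = bil A a v + bil A b v.
Proof. by rewrite /bil !mulmxDl mxE. Qed.

Lemma bilZl A s a v : bil A (s *: a) v = s * bil A a v.
Proof. by rewrite /bil -!scalemxAl mxE. Qed.

Lemma bilBl A a b v : bil A (a - b) v = bil A a v - bil A b v.
Proof. by rewrite bilDl -scaleN1r bilZl mulN1r. Qed.

Lemma bil_suml (I : finType) (P : pred I) A (a : I -> 'rV_n) v :
  bil A (\sum_(i | P i) a i) v = \sum_(i | P i) bil A (a i) v.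
Proof. by rewrite /bil !mulmx_suml summxE. Qed.

Lemma bilDr A a b v : bil A v (a + b) = bil A v a + bil A v b.
Proof. by rewrite /bil linearD/= mulmxDr mxE. Qed.

Lemma bilZm s A a b : bil (s *: A) a b = s * bil A a b.
Proof. by rewrite /bil -scalemxAr -scalemxAl mxE. Qed.

Lemma bilDm A B a b : bil (A + B) a b = bil A a b + bil B a b.
Proof. by rewrite /bil mulmxDr mulmxDl mxE. Qed.

Lemma bilZr A s a v : bil A v (s *: a) = s * bil A v a.
Proof. by rewrite /bil linearZ/= -scalemxAr mxE. Qed.

Lemma bilBr A a b v : bil A v (a - b) = bil A v a - bil A v b.
Proof. by rewrite bilDr -scaleN1r bilZr mulN1r. Qed.

Lemma bil0r A v : bil A v 0 = 0.
Proof. by rewrite /bil linear0 mulmx0 mxE. Qed.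

Lemma bil_sumr (I : finType) (P : pred I) A (a : I -> 'rV_n) v :
  bil A v (\sum_(i | P i) a i) = \sum_(i | P i) bil A v (a i).
Proof. by rewrite /bil linear_sum/= mulmx_sumr summxE. Qed.

Lemma bil_mxM A (K : 'M[R]_n) a b : bil (K *m A *m K^T) a b = bil A (a *m K) (b *m K).
Proof. by rewrite /bil trmx_mul !mulmxA. Qed.

Lemma bilE A a b : bil A a b = \sum_i \sum_j a 0 i * A i j * b 0 j.
Proof.
rewrite /bil mxE exchange_big/=; apply: eq_bigr => j _; rewrite !mxE mulr_suml.
by apply: eq_bigr.
Qed.

Definition drow F u : 'rV[R]_n := \row_i pderiv i F u.

Lemma drowE F u v : differentiable F u -> 'D_v F u = (v *m (drow F u)^T) 0 0.
Proof.
by move=> dF; rewrite derive_pderiv// mxE; apply: eq_bigr => i _; rewrite !mxE.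
Qed.

Lemma derive_coord (p q : nat) (A : 'rV[R]_n -> 'M[R]_(p, q)) u v i j :
  differentiable A u -> 'D_v A u i j = \sum_k v 0 k * pderiv k (fun w => A w i j) u.
Proof.
move=> dA; rewrite derive_mx; last exact: diff_derivable.
by rewrite mxE derive_pderiv//; exact: differentiable_entry.
Qed.

Lemma derive_trmx (p q : nat) (A : 'rV[R]_n -> 'M[R]_(p, q)) u v :
  differentiable A u -> ('D_v A u)^T = 'D_v (fun w => (A w)^T) u.
Proof.
move=> dA; have /derivableP/is_derive_trmx[_ ->] // := @diff_derivable _ _ _ A u v dA.
Qed.

Lemma Ck_on_differentiable U F k u : Ck_on k.+1 U F -> U u -> differentiable F u.
Proof. by case=> + _; apply. Qed.

Lemma Ck_on_drow U F k u : Ck_on k.+2 U F -> U u -> differentiable (drow F) u.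
Proof.
move=> [_ CF] Uu; apply: differentiable_mx => i j.
rewrite (_ : (fun w => _) = pderiv j F); first exact: Ck_on_differentiable (CF j) Uu.
by apply/funext => w; rewrite mxE.
Qed.

Lemma Ck_on_pderivC U F i j u : open U -> Ck_on 2 U F -> U u ->
  pderiv i (pderiv j F) u = pderiv j (pderiv i F) u.
Proof.
move=> oU [dF CF] Uu; apply: derive_commute.
- have : nbhs u U by exact: open_nbhs_nbhs.
  by apply: filterS => w Uw; split; [exact: dF|exact: (CF j).1|exact: (CF i).1].
- by have [_] := CF j; move=> /(_ i); apply.
- by have [_] := CF i; move=> /(_ j); apply.
Qed.

Lemma derive_drowC U F u v w : open U -> Ck_on 2 U F -> U u ->
  v *m ('D_w (drow F) u)^T = w *m ('D_v (drow F) u)^T.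
Proof.
move=> oU CF Uu.
have E x i : 'D_x (drow F) u 0 i = \sum_k x 0 k * pderiv k (pderiv i F) u.
  rewrite (derive_coord _ _ _ (Ck_on_drow CF Uu)); apply: eq_bigr => k _.
  by congr (_ * pderiv k _ u); apply/funext => y; rewrite mxE.
apply/matrixP => i0 j0; rewrite !ord1 ![LHS]mxE [RHS]mxE.
transitivity (\sum_i \sum_k v 0 i * (w 0 k * pderiv k (pderiv i F) u)).
  by apply: eq_bigr => i _; rewrite mxE E mulr_sumr.
rewrite exchange_big/=; apply: eq_bigr => i _; rewrite mxE E mulr_sumr.
apply: eq_bigr => j _.
by rewrite (Ck_on_pderivC i j oU CF Uu) mulrCA.
Qed.

(* The Hessian quadratic form <Hess F xi, xi> at u in a coordinate system with
   Gram matrix G and gradient X, with the Christoffel symbols expanded. *)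
Definition hess_form F G u xi X : R :=
  (xi *m ('D_xi (drow F) u)^T) 0 0 - bil ('D_xi G u) X xi
  + 2^-1 * bil ('D_X G u) xi xi.

(** Differentiating the transformation rules of the differential and of the Gram matrix produces
    terms in the derivative of [J]. The one from ['D_xi (drow Fc)] pairs with [X *m J u], the
    gradient in the new coordinates, and cancels one of the two from ['D_xi Gc]. The other cancels
    half the sum of the two from ['D_X Gc], after the symmetry of second derivatives turns
    [X *m 'D_xi J u] into [xi *m 'D_X J u]. *)
Lemma hess_form_change (tau : 'rV[R]_n -> 'rV[R]_n) (J : 'rV[R]_n -> 'M[R]_n)
    Fc Fd Gc Gd u xi X :
  differentiable tau u -> (forall v, 'D_v tau u = v *m J u) ->
  differentiable J u -> (forall v w, v *m 'D_w J u = w *m 'D_v J u) ->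
  differentiable (drow Fd) (tau u) -> differentiable Gd (tau u) ->
  (\forall w \near u, drow Fd (tau w) *m (J w)^T = drow Fc w) ->
  (\forall w \near u, J w *m Gd (tau w) *m (J w)^T = Gc w) ->
  (Gd (tau u))^T = Gd (tau u) ->
  (X *m J u) *m Gd (tau u) = drow Fd (tau u) ->
  hess_form Fc Gc u xi X = hess_form Fd Gd (tau u) (xi *m J u) (X *m J u).
Proof.
move=> dtau Dtau dJ symJ dFd dGd eF eG sG eX.
have isJ v := derivableP (@diff_derivable _ _ _ J u v dJ).
have isG v := derive_comp v dtau dGd; have isF v := derive_comp v dtau dFd.
have EF v : 'D_v (drow Fc) u =
    'D_(v *m J u) (drow Fd) (tau u) *m (J u)^T + drow Fd (tau u) *m ('D_v J u)^T.
  have := is_derive_mulmx (isF v) (is_derive_trmx (isJ v)).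
  by move=> /(near_eq_is_derive eF)[_ ->]; rewrite Dtau.
have EG v : 'D_v Gc u =
    'D_v J u *m Gd (tau u) *m (J u)^T + J u *m 'D_(v *m J u) Gd (tau u) *m (J u)^T
    + J u *m Gd (tau u) *m ('D_v J u)^T.
  have := is_derive_mulmx (is_derive_mulmx (isJ v) (isG v)) (is_derive_trmx (isJ v)).
  by move=> /(near_eq_is_derive eG)[_ ->]; rewrite Dtau mulmxDl.
have bilD3 (A B C : 'M[R]_n) (a b : 'rV[R]_n) : bil (A + B + C) a b = bil A a b + bil B a b + bil C a b.
  by rewrite !bilDm.
have EB v a b : bil ('D_v Gc u) a b =
    bil (Gd (tau u)) (a *m 'D_v J u) (b *m J u)
    + bil ('D_(v *m J u) Gd (tau u)) (a *m J u) (b *m J u)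
    + bil (Gd (tau u)) (a *m J u) (b *m 'D_v J u).
  rewrite EG bilD3 bil_mxM; congr (_ + _ + _); last by rewrite /bil trmx_mul !mulmxA.
  by rewrite /bil trmx_mul !mulmxA.
have T0 : (xi *m ('D_xi (drow Fc) u)^T) 0 0 =
   (xi *m J u *m ('D_(xi *m J u) (drow Fd) (tau u))^T) 0 0 +
   bil (Gd (tau u)) (X *m J u) (xi *m 'D_xi J u).
  rewrite EF linearD/= mulmxDr mxE !trmx_mul !trmxK mulmxA; congr (_ + _).
  by rewrite /bil eX dot_rVC mulmxA.
have T1 := EB xi X xi; have T2 := EB X xi xi.
rewrite -(symJ xi X) in T1.
have T3 := bilC (xi *m 'D_X J u) (xi *m J u) sG.
(* [m], [s] and [s'] are the terms containing a derivative of [J]; [h], [q] and [r] make up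
   [hess_form] in the new coordinates. *)
have cancel (A B C h m s q r s' : R) : A = h + m -> B = s + q + m ->
    C = s + r + s' -> s = s' -> A - B + 2^-1 * C = h - q + 2^-1 * r.
  by move=> -> -> -> ->; field.
exact: cancel T0 T1 T2 T3.
Qed.

End LocalForm.

(** * Charts, Gram matrices and gradients *)

Section Charts.
Context {R : realType} {n : nat} {M : smoothManifold R n}.
Implicit Types (c d e : chart R n M) (u v w xi : 'rV[R]_n) (f : M -> R).

Definition overlap c d : set 'rV[R]_n := ctgt c `&` cinv c @^-1` csrc d.

Definition transition c d u : 'rV[R]_n := cfwd d (cinv c u).

Definition jac c d u : 'M[R]_n :=
  \matrix_(i, j) pderiv i (fun w => transition c d w 0 j) u.

Lemma overlap_fwd c d x : csrc c x -> csrc d x -> overlap c d (cfwd c x).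
Proof. by move=> cx dx; split; [exact: cfwd_tgt|rewrite /= cfwdK]. Qed.

Lemma transition_fwd c d x : csrc c x -> transition c d (cfwd c x) = cfwd d x.
Proof. by move=> cx; rewrite /transition cfwdK. Qed.

Lemma overlap_transition c d e u :
  overlap c d u -> overlap c e u -> overlap d e (transition c d u).
Proof. by move=> [_ du] [_ eu]; exact: overlap_fwd. Qed.

Lemma overlap_id c u : ctgt c u -> overlap c c u.
Proof. by move=> cu; split=> //; exact: cinv_src. Qed.

Lemma open_overlap c d : open (overlap c d).
Proof.
rewrite openE => u [cu du]; rewrite /interior; apply: filterI.
  by apply: open_nbhs_nbhs; split=> //; exact: ctgt_open.
apply: (cinv_cont cu); apply: open_nbhs_nbhs; split=> //; exact: csrc_open.
Qed.

Lemma nbhs_overlap c d u : overlap c d u -> nbhs u (overlap c d).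
Proof. by move=> cdu; apply: open_nbhs_nbhs; split=> //; exact: open_overlap. Qed.

Section Transition.
Variables (c d : chart R n M) (ac : atlas c) (ad : atlas d).

Lemma differentiable_transition u :
  overlap c d u -> differentiable (transition c d) u.
Proof.
move=> cdu; apply: differentiable_mx => i j; rewrite ord1.
exact: Ck_on_differentiable (transition_smooth ac ad j 1) cdu.
Qed.

Lemma derive_transition u v :
  overlap c d u -> 'D_v (transition c d) u = v *m jac c d u.
Proof.
move=> cdu; apply/rowP => j; rewrite derive_coord; last exact: differentiable_transition.
by rewrite mxE; apply: eq_bigr => i _; rewrite !mxE.
Qed.

Lemma differentiable_jac u : overlap c d u -> differentiable (jac c d) u.
Proof.
move=> cdu; apply: differentiable_mx => i j.
rewrite (_ : (fun w => _) = pderiv i (fun w => transition c d w 0 j)).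
  have CF : Ck_on 1 (overlap c d) (pderiv i (fun w => transition c d w 0 j)).
    by have [_] := transition_smooth ac ad j 2; apply.
  exact: Ck_on_differentiable CF cdu.
by apply/funext => w; rewrite mxE.
Qed.

Lemma derive_jacC u v w :
  overlap c d u -> v *m 'D_w (jac c d) u = w *m 'D_v (jac c d) u.
Proof.
move=> cdu.
have E x i j : 'D_x (jac c d) u i j =
    \sum_k x 0 k * pderiv k (pderiv i (fun w => transition c d w 0 j)) u.
  rewrite (derive_coord _ _ _ (differentiable_jac cdu)); apply: eq_bigr => k _.
  by congr (_ * pderiv k _ u); apply/funext => y; rewrite mxE.
apply/rowP => j; rewrite [LHS]mxE [RHS]mxE.
transitivity (\sum_i \sum_k v 0 i * (w 0 k *
    pderiv k (pderiv i (fun w => transition c d w 0 j)) u)).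
  by apply: eq_bigr => i _; rewrite E mulr_sumr.
rewrite exchange_big/=; apply: eq_bigr => i _; rewrite E mulr_sumr.
apply: eq_bigr => k _.
have CF := transition_smooth ac ad j 2.
by rewrite (Ck_on_pderivC i k (@open_overlap c d) CF cdu) mulrCA.
Qed.

Lemma tcoordE x xi : csrc c x -> csrc d x ->
  tcoord c d x xi = xi *m jac c d (cfwd c x).
Proof. by move=> cx dx; rewrite -derive_transition//; exact: overlap_fwd. Qed.

End Transition.

Lemma jac_id c u : atlas c -> ctgt c u -> jac c c u = 1%:M.
Proof.
move=> ac cu; apply/row_matrixP => i; rewrite !rowE -derive_transition//; last first.
  exact: overlap_id.
rewrite mulmx1 -[RHS](derive_id u); apply: near_eq_derive.
have : nbhs u (overlap c c) by exact/nbhs_overlap/overlap_id.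
by apply: filterS => w [cw _]; rewrite /transition cinvK.
Qed.

Lemma jac_comp c d e u : atlas c -> atlas d -> atlas e ->
  overlap c d u -> overlap c e u ->
  jac c e u = jac c d u *m jac d e (transition c d u).
Proof.
move=> ac ad ae cdu ceu; have deu := overlap_transition cdu ceu.
apply/row_matrixP => i; rewrite !rowE mulmxA -!derive_transition//.
have [_ <-] := derive_comp (delta_mx 0 i) (differentiable_transition ac ad cdu)
  (differentiable_transition ad ae deu).
apply: near_eq_derive; have : nbhs u (overlap c d) by exact: nbhs_overlap.
by apply: filterS => w [cw dw]; rewrite /transition/= cfwdK.
Qed.

Lemma jac_unit c d u : atlas c -> atlas d -> overlap c d u -> jac c d u \in unitmx.
Proof.
move=> ac ad cdu; have cu : ctgt c u by case: cdu.
have := jac_comp ac ad ac cdu (overlap_id cu).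
by rewrite jac_id// => /esym/mulmx1_unit[].
Qed.

Lemma drow_change k f c d u : manCk k.+1 f -> atlas c -> atlas d -> overlap c d u ->
  drow (f \o cinv c) u = drow (f \o cinv d) (transition c d u) *m (jac c d u)^T.
Proof.
move=> Cf ac ad cdu; have [cu du] := cdu.
have dt := differentiable_transition ac ad cdu.
have df : differentiable (f \o cinv d) (transition c d u).
  by apply: Ck_on_differentiable (Cf d ad) _; exact: cfwd_tgt.
apply/rowP => i; rewrite mxE /pderiv.
have [_ E] := derive_comp (delta_mx 0 i) dt df.
have -> : 'D_(delta_mx 0 i) (f \o cinv c) u =
    'D_(delta_mx 0 i) ((f \o cinv d) \o transition c d) u.
  apply: near_eq_derive; have : nbhs u (overlap c d) by exact: nbhs_overlap.
  by apply: filterS => w [cw dw]; rewrite /transition/= cfwdK.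
rewrite E drowE// derive_transition// dot_rVC trmx_mul mulmxA mxE.
rewrite (bigD1 i)//= big1 ?addr0 => [|k' k'i]; rewrite !mxE ?eqxx ?mulr1//.
by rewrite (negbTE k'i) andbF mulr0.
Qed.

End Charts.

(** * Gram matrices and gradients under change of chart *)

Section Metric.
Context {R : realType} {n : nat} {M : riemannianManifold R n}.
Implicit Types (x : M) (c d e : chart R n M) (u v w xi eta : 'rV[R]_n) (f : M -> R).

Lemma gramE c u : atlas c -> ctgt c u ->
  let K := jac c (chart_at (cinv c u)) u in
  gram c u = K *m metric (cinv c u) *m K^T.
Proof.
move=> ac cu K; apply/matrixP => i j.
have cx : csrc c (cinv c u) by exact: cinv_src.
have aa := chart_at_atlas (cinv c u); have sa := chart_at_src (cinv c u).
rewrite /gram /chart_gram mxE !tcoordE// cinvK// -/K trmx_mul trmx_delta.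
by rewrite -!mulmxA -rowE mxE !mulmxA -colE mxE.
Qed.

Lemma gram_bil c u xi eta : atlas c -> ctgt c u ->
  let K := jac c (chart_at (cinv c u)) u in
  bil (gram c u) xi eta = inner (cinv c u) (xi *m K) (eta *m K).
Proof. by move=> ac cu K; rewrite gramE// bil_mxM. Qed.

Lemma gram_sym c u : atlas c -> ctgt c u -> (gram c u)^T = gram c u.
Proof. by move=> ac cu; rewrite gramE// !trmx_mul trmxK Defs.metric_sym mulmxA. Qed.

Lemma gram_gt0 c u xi : atlas c -> ctgt c u -> xi != 0 -> 0 < bil (gram c u) xi xi.
Proof.
move=> ac cu xi0; rewrite gram_bil//; apply: metric_pos.
set K := jac _ _ _.
have uK : K \in unitmx.
  apply: jac_unit; [by []|exact: chart_at_atlas|].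
  by split=> //; exact: chart_at_src.
by apply: contra_neq xi0 => H; rewrite -(mulmxK uK xi) H mul0mx.
Qed.

Lemma gram_unit c u : atlas c -> ctgt c u -> gram c u \in unitmx.
Proof.
move=> ac cu; rewrite -row_free_unit -kermx_eq0; apply/eqP/row_matrixP => i.
rewrite row0; apply/eqP/negPn/negP => /(gram_gt0 ac cu).
by rewrite /bil -row_mul mulmx_ker row0 mul0mx mxE ltxx.
Qed.

Lemma gram_fwd x : let c := chart_at x in gram c (cfwd c x) = metric x.
Proof.
move=> c; have cx : csrc c x by exact: chart_at_src.
have ac : atlas c by exact: chart_at_atlas.
rewrite gramE//; last exact: cfwd_tgt.
by rewrite cfwdK// jac_id ?trmx1 ?mulmx1 ?mul1mx//; exact: cfwd_tgt.
Qed.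

Lemma differentiable_gram c u : atlas c -> ctgt c u -> differentiable (gram c) u.
Proof.
move=> ac cu; apply: differentiable_mx => i j.
exact: Ck_on_differentiable (metric_smooth ac i j 1) cu.
Qed.

Lemma gram_change c d u : atlas c -> atlas d -> overlap c d u ->
  jac c d u *m gram d (transition c d u) *m (jac c d u)^T = gram c u.
Proof.
move=> ac ad cdu; have [cu du] := cdu.
rewrite gramE//; last exact: cfwd_tgt.
rewrite cfwdK// [RHS]gramE//.
have a := chart_at_atlas (cinv c u).
rewrite [in RHS](jac_comp ac ad a cdu); last by split=> //; exact: chart_at_src.
by rewrite !trmx_mul !mulmxA.
Qed.

Lemma chart_gradM f c u : atlas c -> ctgt c u ->
  chart_grad f c u *m gram c u = drow (f \o cinv c) u.
Proof. by move=> ac cu; rewrite mulmxKV//; exact: gram_unit. Qed.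

Lemma chart_grad_change k f c d u : manCk k.+1 f -> atlas c -> atlas d ->
  overlap c d u -> chart_grad f d (transition c d u) = chart_grad f c u *m jac c d u.
Proof.
move=> Cf ac ad cdu; have [cu du] := cdu.
have dtu : ctgt d (transition c d u) by exact: cfwd_tgt.
have uG := gram_unit ad dtu; have uJ := jac_unit ac ad cdu.
have uJt : (jac c d u)^T \in unitmx by rewrite unitmx_tr.
have E : drow (f \o cinv d) (transition c d u) =
    chart_grad f c u *m jac c d u *m gram d (transition c d u).
  rewrite -[LHS](mulmxK uJt) -(drow_change Cf ac ad cdu) -(chart_gradM f ac cu).
  by rewrite -(gram_change ac ad cdu) !mulmxA (mulmxK uJt).
by rewrite -[RHS](mulmxK uG) -E.
Qed.

Lemma grad_jac k f c x : manCk k.+1 f -> atlas c -> csrc c x ->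
  grad f x = chart_grad f c (cfwd c x) *m jac c (chart_at x) (cfwd c x).
Proof.
move=> Cf ac cx; have sa := chart_at_src x.
rewrite -(chart_grad_change Cf ac (chart_at_atlas x)) ?transition_fwd//.
exact: overlap_fwd.
Qed.

Lemma inner_jac c x xi eta : atlas c -> csrc c x ->
  let K := jac c (chart_at x) (cfwd c x) in
  inner x (xi *m K) (eta *m K) = bil (gram c (cfwd c x)) xi eta.
Proof. by move=> ac cx K; rewrite gram_bil ?cfwdK//; exact: cfwd_tgt. Qed.

(** As [invmx] is defined by cases, regularity is proved for the adjugate quotient and transferred
    through equality near [u]. *)
Lemma chart_grad_regular f c u v : manCk 2 f -> atlas c -> ctgt c u ->
  derivable (chart_grad f c) u v /\ {for u, continuous (chart_grad f c)}.
Proof.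
move=> Cf ac cu.
have dF : differentiable (drow (f \o cinv c)) u by exact: Ck_on_drow (Cf c ac) cu.
have dG := differentiable_gram ac cu; have uG := gram_unit ac cu.
have dX := differentiable_mulmx dF (differentiable_adj_det dG uG).
have eX := near_invmxE dG uG.
have {}eX : \forall w \near u, drow (f \o cinv c) w *m
    ((\det (gram c w))^-1 *: \adj (gram c w)) = chart_grad f c w.
  by apply: filterS eX => w ->.
split; first exact: near_eq_derivable eX (diff_derivable dX).
rewrite /prop_for /continuous_at -(nbhs_singleton eX).
have cX := differentiable_continuous dX.
exact: cvg_trans (@near_eq_cvg _ _ (nbhs u) _ _ _ eX) cX.
Qed.

End Metric.

(** * The Riemannian Hessian *)

Section Hessian.
Context {R : realType} {n : nat} {M : riemannianManifold R n}.
Implicit Types (x : M) (c d e : chart R n M) (u v w xi eta : 'rV[R]_n) (f : M -> R).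

Lemma derive_gram_sym c u v : atlas c -> ctgt c u ->
  ('D_v (gram c) u)^T = 'D_v (gram c) u.
Proof.
move=> ac cu; rewrite (derive_trmx _ (differentiable_gram ac cu)).
apply: near_eq_derive.
have : nbhs u (ctgt c) by apply: open_nbhs_nbhs; split=> //; exact: ctgt_open.
by apply: filterS => w cw; rewrite gram_sym.
Qed.

(** Pairing with the Gram matrix cancels the inverse Gram matrix in the Christoffel symbols; what
    remains is the Koszul formula for coordinate fields. *)
Lemma bil_christoffel c u xi X eta : atlas c -> ctgt c u ->
  bil (gram c u) (christoffel c u xi X) eta =
  2^-1 * (bil ('D_xi (gram c) u) X eta + bil ('D_X (gram c) u) xi eta
          - bil ('D_eta (gram c) u) xi X).
Proof.
move=> ac cu; have dG := differentiable_gram ac cu.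
pose T i j l := pderiv i (fun v => gram c v j l) u
       + pderiv j (fun v => gram c v i l) u - pderiv l (fun v => gram c v i j) u.
(* [r] holds the Christoffel symbols of the first kind, contracted with [xi] and [X]. *)
pose r : 'rV[R]_n := \row_l (2^-1 * \sum_i \sum_j xi 0 i * X 0 j * T i j l).
have Er : christoffel c u xi X *m gram c u = r.
  suff -> : christoffel c u xi X = r *m invmx (gram c u).
    by rewrite mulmxKV// gram_unit.
  have sG : (invmx (gram c u))^T = invmx (gram c u) by rewrite trmx_inv gram_sym.
  apply/rowP => k; rewrite [RHS]mxE.
  have R1 l : r 0 l * invmx (gram c u) l k =
      \sum_i \sum_j xi 0 i * X 0 j * (2^-1 * (invmx (gram c u) k l * T i j l)).
    have -> : invmx (gram c u) l k = invmx (gram c u) k l by rewrite -[in LHS]sG mxE.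
    rewrite mxE mulr_sumr mulr_suml; apply: eq_bigr => i _.
    by rewrite mulr_sumr mulr_suml; apply: eq_bigr => j _; ring.
  rewrite (eq_bigr _ (fun l _ => R1 l)) exchange_big/= mxE; apply: eq_bigr => i _.
  rewrite exchange_big/=; apply: eq_bigr => j _.
  by rewrite !mulr_sumr.
have E v i j : 'D_v (gram c) u i j = \sum_k v 0 k * pderiv k (fun w => gram c w i j) u.
  exact: derive_coord.
have E1 : bil ('D_xi (gram c) u) X eta =
    \sum_l \sum_i \sum_j xi 0 i * X 0 j * pderiv i (fun v => gram c v j l) u * eta 0 l.
  rewrite bilE exchange_big/=; apply: eq_bigr => l _; rewrite exchange_big/=.
  apply: eq_bigr => j _; rewrite E mulr_sumr mulr_suml; apply: eq_bigr => i _.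
  by ring.
have E2 : bil ('D_X (gram c) u) xi eta =
    \sum_l \sum_i \sum_j xi 0 i * X 0 j * pderiv j (fun v => gram c v i l) u * eta 0 l.
  rewrite bilE exchange_big/=; apply: eq_bigr => l _.
  apply: eq_bigr => i _; rewrite E mulr_sumr mulr_suml; apply: eq_bigr => j _.
  by ring.
have E3 : bil ('D_eta (gram c) u) xi X =
    \sum_l \sum_i \sum_j xi 0 i * X 0 j * pderiv l (fun v => gram c v i j) u * eta 0 l.
  rewrite bilE [RHS]exchange_big/=; apply: eq_bigr => i _.
  rewrite [RHS]exchange_big/=; apply: eq_bigr => j _.
  rewrite E mulr_sumr mulr_suml; apply: eq_bigr => l _.
  by ring.
have E0 : bil (gram c u) (christoffel c u xi X) eta = \sum_l r 0 l * eta 0 l.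
  by rewrite /bil Er mxE; apply: eq_bigr => l _; congr (_ * _); rewrite mxE.
have subst3 (p q s p' q' s' t : R) : p = p' -> q = q' -> s = s' ->
    t = 2^-1 * (p' + q' - s') -> t = 2^-1 * (p + q - s).
  by move=> -> -> ->.
apply: etrans E0 _; apply: subst3 E1 E2 E3 _.
rewrite -big_split -sumrB/= mulr_sumr; apply: eq_bigr => l _.
rewrite mxE -mulrA; congr (_ * _); rewrite -big_split -sumrB/= mulr_suml.
apply: eq_bigr => i _; rewrite -big_split -sumrB/= mulr_suml; apply: eq_bigr => j _.
by rewrite /T; ring.
Qed.

(** The gradient is differentiated through the identity X G = dF, which gives (DX) G = D(dF) - X
    (DG) without differentiating the inverse of G. The Koszul formula then adds 1/2 to the
    coefficient -1 of the ['D_xi (gram c)] term. *)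
Lemma inner_hess f x xi eta : manCk 2 f ->
  let c := chart_at x in let u := cfwd c x in let X := chart_grad f c u in
  inner x (hess f x xi) eta = (eta *m ('D_xi (drow (f \o cinv c)) u)^T) 0 0
    - 2^-1 * bil ('D_xi (gram c) u) X eta + 2^-1 * bil ('D_X (gram c) u) xi eta
    - 2^-1 * bil ('D_eta (gram c) u) xi X.
Proof.
move=> Cf c u X.
have ac : atlas c by exact: chart_at_atlas.
have cu : ctgt c u by apply: cfwd_tgt; exact: chart_at_src.
have dX : is_derive u xi (chart_grad f c) ('D_xi (chart_grad f c) u).
  by apply: derivableP; have [] := chart_grad_regular xi Cf ac cu.
have dG := derivableP (@diff_derivable _ _ _ (gram c) u xi (differentiable_gram ac cu)).
have E : 'D_xi (chart_grad f c) u *m gram c u =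
    'D_xi (drow (f \o cinv c)) u - X *m 'D_xi (gram c) u.
  apply/eqP; rewrite eq_sym subr_eq; apply/eqP.
  have [_ <-] := is_derive_mulmx dX dG; apply: near_eq_derive.
  have : nbhs u (ctgt c) by apply: open_nbhs_nbhs; split=> //; exact: ctgt_open.
  by apply: filterS => w cw; rewrite chart_gradM.
have -> : inner x (hess f x xi) eta =
    bil (gram c u) ('D_xi (chart_grad f c) u) eta
    + bil (gram c u) (christoffel c u xi X) eta.
  by rewrite -bilDl gram_fwd.
rewrite (bil_christoffel xi X eta ac cu).
have -> : bil (gram c u) ('D_xi (chart_grad f c) u) eta =
    (eta *m ('D_xi (drow (f \o cinv c)) u)^T) 0 0 - bil ('D_xi (gram c) u) X eta.
  by rewrite {1}/bil E mulmxBl mxE dot_rVC; congr (_ + _); rewrite mxE.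
have arith (a b p q : R) : a - b + 2^-1 * (b + p - q) =
  a - 2^-1 * b + 2^-1 * p - 2^-1 * q by field.
exact: arith.
Qed.

(** In [inner_hess] the first term is symmetric by equality of mixed derivatives and the third by
    symmetry of the Gram matrix, while the second and the fourth change places. *)
Lemma hess_symmetric f x xi eta : manCk 2 f ->
  inner x (hess f x xi) eta = inner x (hess f x eta) xi.
Proof.
move=> Cf; rewrite (inner_hess x xi eta Cf) (inner_hess x eta xi Cf)/=.
set c := chart_at x; set u := cfwd c x; set X := chart_grad f c u.
have ac : atlas c by exact: chart_at_atlas.
have cu : ctgt c u by apply: cfwd_tgt; exact: chart_at_src.
have E1 := derive_drowC xi eta (@ctgt_open _ _ _ c) (Cf c ac) cu.
have E2 := bilC X eta (derive_gram_sym xi ac cu).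
have E3 := bilC xi X (derive_gram_sym eta ac cu).
have E4 := bilC xi eta (derive_gram_sym X ac cu).
have arith (a b p q a' b' p' q' : R) : a' = a -> b = q' -> q = b' -> p = p' ->
  a - 2^-1 * b + 2^-1 * p - 2^-1 * q = a' - 2^-1 * b' + 2^-1 * p' - 2^-1 * q'.
  by move=> -> -> -> ->; ring.
exact: arith (congr1 (fun A : 'M[R]_1 => A 0 0) E1) E2 E3 E4.
Qed.

Lemma hess_linear f x : manCk 2 f -> linear (hess f x).
Proof.
move=> Cf a xi eta.
pose z := hess f x (a *: xi + eta) - (a *: hess f x xi + hess f x eta).
suff zz : inner x z z = 0.
  apply/eqP; rewrite -subr_eq0 -/z; apply/negPn/negP => z0.
  have : 0 < inner x z z by exact: metric_pos.
  by rewrite zz ltxx.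
set c := chart_at x; set u := cfwd c x; set X := chart_grad f c u.
have ac : atlas c by exact: chart_at_atlas.
have cu : ctgt c u by apply: cfwd_tgt; exact: chart_at_src.
have dG := differentiable_gram ac cu; have dF := Ck_on_drow (Cf c ac) cu.
have D0 : inner x z z = inner x (hess f x (a *: xi + eta)) z
    - (a * inner x (hess f x xi) z + inner x (hess f x eta) z).
  by rewrite -[LHS]/(bil (metric x) z z) {1}/z bilBl (bilDl _ (a *: _)) bilZl.
have D1 : (z *m ('D_(a *: xi + eta) (drow (f \o cinv c)) u)^T) 0 0 =
    a * (z *m ('D_xi (drow (f \o cinv c)) u)^T) 0 0
    + (z *m ('D_eta (drow (f \o cinv c)) u)^T) 0 0.
  rewrite (deriveDv _ _ dF) (deriveZv _ _ dF) linearD/= linearZ/= mulmxDr mxE.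
  by rewrite -scalemxAr; congr (_ + _); rewrite mxE.
have D2 : bil ('D_(a *: xi + eta) (gram c) u) X z =
    a * bil ('D_xi (gram c) u) X z + bil ('D_eta (gram c) u) X z.
  by rewrite (deriveDv _ _ dG) (deriveZv _ _ dG) bilDm bilZm.
have D3 v : bil ('D_X (gram c) u) (a *: xi + eta) v =
    a * bil ('D_X (gram c) u) xi v + bil ('D_X (gram c) u) eta v.
  by rewrite bilDl bilZl.
have D4 v : bil ('D_z (gram c) u) (a *: xi + eta) v =
    a * bil ('D_z (gram c) u) xi v + bil ('D_z (gram c) u) eta v.
  by rewrite bilDl bilZl.
have H0 := inner_hess x (a *: xi + eta) z Cf.
have H1 := inner_hess x xi z Cf; have H2 := inner_hess x eta z Cf.
have arith (t t0 t1 t2 p0 p1 p2 q0 q1 q2 r0 r1 r2 s0 s1 s2 : R) :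
    t = t0 - (a * t1 + t2) ->
    t0 = p0 - 2^-1 * q0 + 2^-1 * r0 - 2^-1 * s0 ->
    t1 = p1 - 2^-1 * q1 + 2^-1 * r1 - 2^-1 * s1 ->
    t2 = p2 - 2^-1 * q2 + 2^-1 * r2 - 2^-1 * s2 ->
    p0 = a * p1 + p2 -> q0 = a * q1 + q2 -> r0 = a * r1 + r2 ->
    s0 = a * s1 + s2 -> t = 0.
  by move=> -> -> -> -> -> -> -> ->; ring.
exact: arith D0 H0 H1 H2 D1 D2 (D3 z) (D4 X).
Qed.

(** The left side lives in [chart_at x], the right side in an arbitrary chart [c]. With [c] fixed,
    the right side can be followed as [x] moves. *)
Lemma inner_hess_chart f c x xi : manCk 2 f -> atlas c -> csrc c x ->
  let u := cfwd c x in let K := jac c (chart_at x) u in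
  inner x (hess f x (xi *m K)) (xi *m K) =
  hess_form (f \o cinv c) (gram c) u xi (chart_grad f c u).
Proof.
move=> Cf ac cx u K; set d := chart_at x.
have ad : atlas d by exact: chart_at_atlas.
have sd : csrc d x by exact: chart_at_src.
have cdu : overlap c d u by exact: overlap_fwd.
have cu : ctgt c u by exact: cfwd_tgt.
have Etu : transition c d u = cfwd d x by exact: transition_fwd.
have du : ctgt d (transition c d u) by rewrite Etu; exact: cfwd_tgt.
have near_ov : nbhs u (overlap c d) by exact: nbhs_overlap.
rewrite (@hess_form_change _ _ (transition c d) (jac c d) _ (f \o cinv d) _ (gram d)).
- rewrite (inner_hess x _ _ Cf)/= /hess_form -/d -/K Etu.
  have -> : chart_grad f c u *m K = chart_grad f d (cfwd d x).
    by rewrite -Etu (chart_grad_change Cf ac ad cdu).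
  set X := chart_grad f d _; set z := xi *m K.
  have E := bilC z X (derive_gram_sym z ad (cfwd_tgt sd)).
  have arith (a b p q : R) : q = b ->
      a - 2^-1 * b + 2^-1 * p - 2^-1 * q = a - b + 2^-1 * p.
    by move=> ->; field.
  exact: arith.
- exact: differentiable_transition.
- by move=> v; exact: derive_transition.
- exact: differentiable_jac.
- by move=> v w; exact: derive_jacC.
- exact: Ck_on_drow (Cf d ad) du.
- exact: differentiable_gram.
- by apply: filterS near_ov => w cdw; rewrite (drow_change Cf ac ad cdw).
- by apply: filterS near_ov => w cdw; rewrite gram_change.
- exact: gram_sym.
- by rewrite -(chart_grad_change Cf ac ad cdu) chart_gradM.
Qed.

End Hessian.

(** * Rayleigh quotients *)

Section Rayleigh.
Context {R : realType} {n : nat}.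
Implicit Types (Q : 'M[R]_n) (v w xi : 'rV[R]_n).

Lemma bil_sqr_le Q v w : Q^T = Q -> (forall z, z != 0 -> 0 < bil Q z z) ->
  bil Q v w ^+ 2 <= bil Q v v * bil Q w w.
Proof.
move=> sQ Qpos; have [->|w0] := eqVneq w 0.
  by rewrite !bil0r expr0n mulr0.
have qw := Qpos w w0.
have Q0 z : 0 <= bil Q z z.
  by have [->|/Qpos/ltW//] := eqVneq z 0; rewrite bil0r.
(* Cauchy-Schwarz comes from positivity at this multiple of the component of [v] orthogonal to
   [w]. *)
have := Q0 (bil Q w w *: v - bil Q v w *: w).
rewrite bilBl !bilBr !bilZl !bilZr (bilC w v sQ).
set a := bil Q v v; set b := bil Q v w; set q := bil Q w w.
rewrite (_ : _ - _ = q * (a * q - b ^+ 2)); last by ring.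
by rewrite pmulr_rge0// subr_ge0.
Qed.

Lemma eq0_of_quadratic_ge0 (b p : R) : 0 <= p ->
  (forall t, 0 <= 2 * t * b + t ^+ 2 * p) -> b = 0.
Proof.
(* Dividing by p + 1 instead of the optimal p also covers p = 0; the value at this point is still a
   negative multiple of b ^ 2. *)
move=> p0 /(_ (- b / (p + 1))); have p1 : 0 < p + 1 by rewrite ltr_wpDl.
rewrite (_ : _ + _ = - (b ^+ 2 * ((p + 2) / (p + 1) ^+ 2))); last by field; rewrite gt_eqF.
rewrite oppr_ge0 pmulr_lle0; last by rewrite divr_gt0 ?exprn_gt0// ltr_wpDl.
by move=> H; apply/eqP; rewrite -sqrf_eq0 eq_le H sqr_ge0.
Qed.

Lemma continuous_bil (N : 'M[R]_n) v : {for v, continuous (fun w => bil N w w)}.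
Proof.
apply: differentiable_continuous.
apply: differentiable_entry; apply: differentiable_mulmx.
  by apply: differentiable_mulmx; [exact: ex_diff|exact: differentiable_cst].
apply: differentiable_mx => i j; rewrite (_ : (fun w => _) = fun w => w j i).
  exact: differentiable_coord.
by apply/funext => w; rewrite mxE.
Qed.

(* At a minimizer v of the Rayleigh quotient the nonnegative form
   <(A - lambda) w, w> vanishes, which makes v an eigenvector of A. *)
Lemma lambda_min_bil_le Q (A : 'rV[R]_n -> 'rV[R]_n) xi :
  Q^T = Q -> (forall z, z != 0 -> 0 < bil Q z z) -> linear A ->
  (forall v w, bil Q (A v) w = bil Q (A w) v) ->
  lambda_min A * bil Q xi xi <= bil Q (A xi) xi.
Proof.
move=> sQ Qpos linA symA.
pose AM := GRing.isLinear.Build _ _ _ _ A linA.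
pose AL : {linear 'rV[R]_n -> 'rV[R]_n} := HB.pack A AM.
have lin1A v : v *m lin1_mx A = A v by exact: (mul_rV_lin1 AL).
have Q0 z : 0 <= bil Q z z.
  by have [->|/Qpos/ltW//] := eqVneq z 0; rewrite bil0r.
have AZ a v : A (a *: v) = a *: A v by rewrite -!lin1A scalemxAl.
have AD v w : A (v + w) = A v + A w by rewrite -!lin1A mulmxDl.
(* A nonzero [xi] guarantees that the unit sphere below is nonempty, which fails in dimension 0. *)
have [->|xi0] := eqVneq xi 0; first by rewrite !bil0r mulr0.
(* The sphere need not be the one of [Q]: [rho] is invariant under scaling, so a minimum on any
   compact sphere is a minimum over all nonzero vectors. *)
pose S := [set v : 'rV[R]_n | `|v| = 1].
have S_neq0 v : S v -> v != 0.
  by rewrite /S/= => v1; rewrite -normr_gt0 v1 ltr01.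
pose nrm v := `|v|^-1 *: v.
have S_nrm v : v != 0 -> S (nrm v).
  by move=> v0; rewrite /S/= /nrm normrZ normfV normr_id mulVf// normr_eq0.
have cS : compact S.
  apply: bounded_closed_compact.
    by exists 1; split=> // t t1 v /= ->; exact: ltW.
  rewrite (_ : S = (fun v : 'rV[R]_n => `|v|) @^-1` [set 1 : R])//.
  by apply: preimage_closed => // v _; exact: norm_continuous.
pose rho v := bil Q (A v) v / bil Q v v.
have rho_cont : {within S, continuous rho}.
  apply: continuous_in_subspaceT => v /set_mem/S_neq0 v0.
  have c1 : (fun v => bil Q (A v) v) @ v --> bil Q (A v) v.
    have E : (fun v => bil Q (A v) v) = fun v => bil (lin1_mx A *m Q) v v.
      by apply/funext => w; rewrite /bil -lin1A !mulmxA.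
    have := @continuous_bil (lin1_mx A *m Q) v.
    by rewrite /prop_for /continuous_at -E (congr1 (fun h => h v) (esym E)).
  apply: cvgM c1 _; apply: cvgV; first by rewrite gt_eqF// Qpos.
  exact: continuous_bil.
have [|v0 /set_mem Sv0 minv0] := EVT_min_rV _ cS rho_cont.
  by exists (nrm xi); exact: S_nrm.
have v00 := S_neq0 _ Sv0; have qv0 := Qpos _ v00.
set l := rho v0 in minv0.
have El : bil Q (A v0) v0 = l * bil Q v0 v0 by rewrite /l /rho divfK// gt_eqF.
have P0 v : l * bil Q v v <= bil Q (A v) v.
  have [->|vn0] := eqVneq v 0; first by rewrite !bil0r mulr0.
  have /mem_set/minv0 := S_nrm v vn0.
  rewrite /rho /nrm AZ !bilZl !bilZr; set k := `|v|^-1.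
  have k0 : k != 0 by rewrite invr_eq0 normr_eq0.
  rewrite (_ : _ / _ = bil Q (A v) v / bil Q v v); last first.
    by field; rewrite k0 gt_eqF// Qpos.
  by rewrite ler_pdivlMr// Qpos.
have Av0 : A v0 = l *: v0.
  apply/eqP; rewrite -subr_eq0; apply/eqP; set w := A v0 - l *: v0.
  have bw : bil Q w w = 0.
    have : bil Q w w = bil Q (A v0) w - l * bil Q v0 w.
      by rewrite {1}/w bilBl bilZl.
    move: w => w E3.
    (* The quadratic in t is the nonnegative form of [A] - l at [v0 + t *: w]: its constant term
       vanishes, and its linear coefficient is twice [bil Q w w] because [w] is the defect
       [A v0 - l *: v0]. *)
    apply: (@eq0_of_quadratic_ge0 _ (bil Q (A w) w - l * bil Q w w)).
      by rewrite subr_ge0.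
    move=> t; have := P0 (v0 + t *: w).
    have E1 : bil Q (A (v0 + t *: w)) (v0 + t *: w) = bil Q (A v0) v0
        + t * bil Q (A v0) w + t * bil Q (A v0) w + t ^+ 2 * bil Q (A w) w.
      rewrite AD AZ bilDl !(bilDr, bilZl, bilZr) (symA w v0); ring.
    have E2 : bil Q (v0 + t *: w) (v0 + t *: w) = bil Q v0 v0
        + t * bil Q v0 w + t * bil Q v0 w + t ^+ 2 * bil Q w w.
      rewrite bilDl !(bilDr, bilZl, bilZr) (bilC w v0 sQ); ring.
    have E4 : bil Q (A v0) w = bil Q w w + l * bil Q v0 w by rewrite E3 subrK.
    rewrite E1 E2 E4 El -subr_ge0 => /le_trans; apply; rewrite le_eqVlt; apply/orP.
    by left; apply/eqP; ring.
  by apply/eqP/negPn/negP => /Qpos; rewrite bw ltxx.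
have Pl : [set a | eigenvalue (lin1_mx A) a] l.
  by apply/eigenvalueP; exists v0 => //; rewrite lin1A.
apply: le_trans (P0 xi); rewrite ler_wpM2r//.
(* [inf] lies below its members only for a set bounded below; [P0] shows that [l] bounds every
   eigenvalue. *)
apply: ge_inf => //; exists l => a /eigenvalueP[v]; rewrite lin1A => Av vn0.
by have := P0 v; rewrite Av bilZl ler_pM2r// Qpos.
Qed.

End Rayleigh.

(** * Entrywise limits *)

Section EntrywiseLimits.
Context {R : realType}.

Definition mcvg (p q : nat) (A : nat -> 'M[R]_(p, q)) (L : 'M[R]_(p, q)) :=
  forall i j, (fun k => A k i j) @ \oo --> L i j.

Lemma cvg_sumr (I : Type) (s : seq I) (P : pred I) (u : I -> nat -> R) (l : I -> R) :
  (forall i, P i -> u i @ \oo --> l i) ->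
  (fun k => \sum_(i <- s | P i) u i k) @ \oo --> \sum_(i <- s | P i) l i.
Proof. by move=> ul; apply: cvg_big => //; exact: add_continuous. Qed.

Lemma cvg0_sum (I : finType) (u : I -> nat -> R) :
  (forall i, u i @ \oo --> (0 : R)) -> (fun k => \sum_i u i k) @ \oo --> (0 : R).
Proof.
move=> u0; have E : \sum_(i : I) (0 : R) = 0 by rewrite big1.
by rewrite -[X in _ --> X]E; apply: cvg_sumr => i _; exact: u0.
Qed.

Lemma cvg_prodr (I : Type) (s : seq I) (P : pred I) (u : I -> nat -> R) (l : I -> R) :
  (forall i, P i -> u i @ \oo --> l i) ->
  (fun k => \prod_(i <- s | P i) u i k) @ \oo --> \prod_(i <- s | P i) l i.
Proof. by move=> ul; apply: cvg_big => //; exact: mul_continuous. Qed.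

Lemma mcvg_cst (p q : nat) (A : 'M[R]_(p, q)) : mcvg (fun=> A) A.
Proof. by move=> i j; exact: cvg_cst. Qed.

Lemma mcvgZ (p q : nat) (s : nat -> R) (A : nat -> 'M[R]_(p, q)) (l : R) L :
  s @ \oo --> l -> mcvg A L -> mcvg (fun k => s k *: A k) (l *: L).
Proof.
move=> sl AL i j; rewrite mxE.
under eq_fun do rewrite mxE.
exact: cvgM sl (AL i j).
Qed.

Lemma mcvgB (p q : nat) (A B : nat -> 'M[R]_(p, q)) K L :
  mcvg A K -> mcvg B L -> mcvg (fun k => A k - B k) (K - L).
Proof.
move=> AK BL i j; rewrite !mxE.
under eq_fun do rewrite !mxE.
exact: cvgB (AK i j) (BL i j).
Qed.

Lemma mcvg_sum (p q : nat) (I : finType) (A : I -> nat -> 'M[R]_(p, q)) L :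
  (forall i, mcvg (A i) (L i)) -> mcvg (fun k => \sum_i A i k) (\sum_i L i).
Proof.
move=> AL i j; rewrite summxE; under eq_fun do rewrite summxE.
by apply: cvg_sumr => l _; exact: AL.
Qed.

Lemma mcvgM (p q r : nat) (A : nat -> 'M[R]_(p, q)) (B : nat -> 'M[R]_(q, r)) K L :
  mcvg A K -> mcvg B L -> mcvg (fun k => A k *m B k) (K *m L).
Proof.
move=> AK BL i j; rewrite mxE; under eq_fun do rewrite mxE.
by apply: cvg_sumr => l _; exact: cvgM (AK i l) (BL l j).
Qed.

Lemma mcvg_tr (p q : nat) (A : nat -> 'M[R]_(p, q)) L :
  mcvg A L -> mcvg (fun k => (A k)^T) L^T.
Proof. by move=> AL i j; rewrite mxE; under eq_fun do rewrite mxE; exact: AL. Qed.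

Lemma cvg_bil (n : nat) (A : nat -> 'M[R]_n) (a b : nat -> 'rV[R]_n) K v w :
  mcvg A K -> mcvg a v -> mcvg b w ->
  (fun k => bil (A k) (a k) (b k)) @ \oo --> bil K v w.
Proof. by move=> AK av bw; exact: mcvgM (mcvgM av AK) (mcvg_tr bw) 0 0. Qed.

Lemma cvg_det (n : nat) (A : nat -> 'M[R]_n) L :
  mcvg A L -> (fun k => \det (A k)) @ \oo --> \det L.
Proof.
move=> AL; apply: cvg_sumr => s _; apply: cvgM; first exact: cvg_cst.
by apply: cvg_prodr => i _; exact: AL.
Qed.

Lemma mcvg_adj (n : nat) (A : nat -> 'M[R]_n) L :
  mcvg A L -> mcvg (fun k => \adj (A k)) (\adj L).
Proof.
move=> AL i j; rewrite mxE; under eq_fun do rewrite mxE.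
apply: cvgM; first exact: cvg_cst.
by apply: cvg_det => k l; rewrite !mxE; under eq_fun do rewrite !mxE; exact: AL.
Qed.

(** Cramer's formula reduces the limit to determinants and adjugates. Every [A k] has to be
    invertible, since [invmx] returns its argument otherwise. *)
Lemma mcvg_invmxM (n q : nat) (A : nat -> 'M[R]_n) (b : nat -> 'M[R]_(n, q)) L c :
  mcvg A L -> L \in unitmx -> (forall k, A k \in unitmx) -> mcvg b c ->
  mcvg (fun k => invmx (A k) *m b k) (invmx L *m c).
Proof.
move=> AL uL uA bc; apply: mcvgM bc; rewrite /invmx uL.
have -> : (fun k => if A k \in unitmx then (\det (A k))^-1 *: \adj (A k) else A k)
    = fun k => (\det (A k))^-1 *: \adj (A k) by apply/funext => k; rewrite uA.
apply: mcvgZ; last exact: mcvg_adj.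
by apply: cvgV; [rewrite -unitfE -unitmxE|exact: cvg_det].
Qed.

Lemma mcvg_cont (p q r : nat) (h : 'M[R]_(p, q) -> 'M[R]_(1, r)) (u : nat -> 'M[R]_(p, q)) l :
  u @ \oo --> l -> {for l, continuous h} -> mcvg (fun k => h (u k)) (h l).
Proof.
move=> ul hl i j.
have := cvg_comp _ _ (cvg_comp _ _ ul hl) (@coord_continuous R 1 r i j (h l)).
by [].
Qed.

Lemma cvg_eqfun (u v : nat -> R) (l : R) : u @ \oo --> l -> u =1 v -> v @ \oo --> l.
Proof. by move=> + /funext <-. Qed.

Lemma cvg0M (u v : nat -> R) (l : R) : u @ \oo --> (0 : R) -> v @ \oo --> l ->
  (fun k => u k * v k) @ \oo --> (0 : R).
Proof. by move=> u0 vl; rewrite -[X in _ --> X](mul0r l); exact: cvgM u0 vl. Qed.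

Lemma cvg_div0 (u v : nat -> R) (l : R) : u @ \oo --> (0 : R) -> v @ \oo --> l ->
  l != 0 -> (fun k => u k / v k) @ \oo --> (0 : R).
Proof. by move=> u0 vl l0; apply: cvg0M u0 _; exact: cvgV l0 vl. Qed.

Lemma cvg0_le (u v : nat -> R) :
  (forall k, `|u k| <= v k) -> v @ \oo --> (0 : R) -> u @ \oo --> (0 : R).
Proof.
move=> uv v0; apply: norm_cvg0; apply: (squeeze_cvgr _ (cvg_cst 0) v0).
by apply: nearW => k; rewrite normr_ge0 uv.
Qed.

Lemma cvg0_sqr_le (u v : nat -> R) :
  (forall k, u k ^+ 2 <= v k) -> v @ \oo --> (0 : R) -> u @ \oo --> (0 : R).
Proof.
move=> uv /cvgrPdist_lt v0; apply/cvgrPdist_lt => e e0.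
have := v0 (e ^+ 2) (exprn_gt0 2 e0); apply: filterS => k.
rewrite !sub0r !normrN => H; rewrite -(@ltr_pXn2r _ 2)// ?nnegrE ?(ltW e0)//.
by apply: le_lt_trans H; rewrite -normrX ger0_norm ?sqr_ge0// (le_trans (uv k))// ler_norm.
Qed.

Lemma cvg_lbound (u : nat -> R) (l b : R) : (forall k, b <= u k) -> u @ \oo --> l -> b <= l.
Proof. by move=> bu ul; apply: (ler_cvg_to (cvg_cst b) ul); exact: nearW. Qed.

Lemma cvg_le_trans (u v : nat -> R) (l l' : R) : (forall k, u k <= v k) ->
  u @ \oo --> l -> v @ \oo --> l' -> l <= l'.
Proof. by move=> uv ul vl; apply: (ler_cvg_to ul vl); exact: nearW. Qed.

Lemma cvg_uniq (u : nat -> R) (l l' : R) : u @ \oo --> l -> u @ \oo --> l' -> l = l'.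
Proof. by move=> ul ul'; exact: cvg_unique ul ul'. Qed.

(** [phi] is continuous only relative to the half-line, so the limit goes through the [within]
    filter, to which positivity of [nu] gives access. *)
Lemma forcing_cvg0 (phi : R -> R) (nu : nat -> R) : forcing_function phi ->
  (forall k, 0 < nu k) -> nu @ \oo --> (0 : R) ->
  (fun k => phi (nu k)) @ \oo --> (0 : R).
Proof.
move=> [cphi _ phi0] nu_gt0 nu0.
have p0 : phi 0 = 0 by exact: (phi0 0 (lexx 0)).2.
have h0 : `[0%R, +oo[%classic (0 : R) by rewrite /= in_itv/= lexx.
have H : phi @ (within `[0%R, +oo[%classic (nbhs (0 : R))) --> phi 0.
  by have := cphi 0; rewrite /continuous_at nbhs_subspace_in.
rewrite -p0; apply: cvg_trans H => A; rewrite /= /within => /= HA.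
have := nu0 _ HA; rewrite /= nbhs_filterE /=; apply: filterS => k; apply.
by rewrite /= in_itv/= andbT ltW.
Qed.

End EntrywiseLimits.

(** * The Lagrangian in a chart *)

Section ChartLimits.
Context {R : realType} {n : nat} {M : riemannianManifold R n}.
Variables (c : chart R n M) (ac : atlas c).
Implicit Types (f : M -> R).

(** Base point and direction move together; expanding in partial derivatives separates the two
    limits. *)
Lemma mcvg_derive (p q : nat) (B : 'rV[R]_n -> 'M[R]_(p, q)) (u v : nat -> 'rV[R]_n)
    (u0 v0 : 'rV[R]_n) :
  (forall k, differentiable B (u k)) -> differentiable B u0 ->
  (forall l i j, {for u0, continuous (pderiv l (fun w => B w i j))}) ->
  u @ \oo --> u0 -> mcvg v v0 ->
  mcvg (fun k => 'D_(v k) B (u k)) ('D_v0 B u0).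
Proof.
move=> dB dB0 cB uu0 vv0 i j; rewrite (derive_coord _ _ _ dB0).
have -> : (fun k => 'D_(v k) B (u k) i j) =
    fun k => \sum_l v k 0 l * pderiv l (fun w => B w i j) (u k).
  by apply/funext => k; exact: derive_coord.
apply: cvg_sumr => l _; apply: cvgM; first exact: vv0.
exact: cvg_comp uu0 (cB l i j).
Qed.

Context (u : nat -> 'rV[R]_n) (u0 : 'rV[R]_n).
Hypotheses (cu : forall k, ctgt c (u k)) (cu0 : ctgt c u0) (uu0 : u @ \oo --> u0).

Lemma mcvg_gram : mcvg (fun k => gram c (u k)) (gram c u0).
Proof.
move=> i j; have dG := differentiable_gram ac cu0.
exact: cvg_comp uu0 (differentiable_continuous (differentiable_entry i j dG)).
Qed.

Lemma mcvg_chart_grad f : manCk 2 f ->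
  mcvg (fun k => chart_grad f c (u k)) (chart_grad f c u0).
Proof.
by move=> Cf; apply: mcvg_cont uu0 _; have [] := chart_grad_regular 0 Cf ac cu0.
Qed.

Lemma cvg_chart_fun k f : manCk k.+1 f ->
  (fun p => f (cinv c (u p))) @ \oo --> f (cinv c u0).
Proof.
move=> Cf; have df := Ck_on_differentiable (Cf c ac) cu0.
exact: cvg_comp uu0 (differentiable_continuous df).
Qed.

Lemma mcvg_derive_drow f v v0 : manCk 2 f -> mcvg v v0 ->
  mcvg (fun k => 'D_(v k) (drow (f \o cinv c)) (u k)) ('D_v0 (drow (f \o cinv c)) u0).
Proof.
move=> Cf vv0; apply: mcvg_derive => //.
- by move=> k; exact: Ck_on_drow (Cf c ac) (cu k).
- exact: Ck_on_drow (Cf c ac) cu0.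
- move=> l i j; rewrite (_ : (fun w => _) = pderiv j (f \o cinv c)).
    by have [_ /(_ j)[_ /(_ l)]] := Cf c ac; apply.
  by apply/funext => w; rewrite mxE.
Qed.

Lemma mcvg_derive_gram v v0 : mcvg v v0 ->
  mcvg (fun k => 'D_(v k) (gram c) (u k)) ('D_v0 (gram c) u0).
Proof.
move=> vv0; apply: mcvg_derive => //.
- by move=> k; exact: differentiable_gram.
- exact: differentiable_gram.
- by move=> l i j; have [_ /(_ l)] := metric_smooth ac i j 1; apply.
Qed.

Lemma cvg_hess_form f v v0 : manCk 2 f -> mcvg v v0 ->
  (fun k => hess_form (f \o cinv c) (gram c) (u k) (v k) (chart_grad f c (u k))) @ \oo
  --> hess_form (f \o cinv c) (gram c) u0 v0 (chart_grad f c u0).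
Proof.
move=> Cf vv0; have X := mcvg_chart_grad Cf.
have h1 := mcvgM vv0 (mcvg_tr (mcvg_derive_drow Cf vv0)).
have h2 := cvg_bil (mcvg_derive_gram vv0) X vv0.
have h3 := cvg_bil (mcvg_derive_gram X) vv0 vv0.
rewrite /hess_form; apply: cvgD.
  by apply: cvgB; [exact: h1|exact: h2].
by apply: cvgM; [exact: cvg_cst|exact: h3].
Qed.

End ChartLimits.

(** * The Lagrangian, the operator H and the stopping conditions in a chart *)

Section LagrangianInChart.
Context {R : realType} {n m : nat} {M : riemannianManifold R n}.
Variables (f : M -> R) (g : 'I_m -> M -> R).
Hypotheses (f_C2 : manCk 2 f) (g_C2 : forall i, manCk 2 (g i)).
Implicit Types (x : M) (y : 'rV[R]_m) (xi eta : 'rV[R]_n).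

Definition chart_grad_L (c : chart R n M) (u : 'rV[R]_n) y : 'rV[R]_n :=
  chart_grad f c u - \sum_i y 0 i *: chart_grad (g i) c u.

Definition hess_form_L (c : chart R n M) (u : 'rV[R]_n) y xi : R :=
  hess_form (f \o cinv c) (gram c) u xi (chart_grad f c u)
  - \sum_i y 0 i * hess_form (g i \o cinv c) (gram c) u xi (chart_grad (g i) c u).

Lemma metric_posdef x xi : xi != 0 -> 0 < bil (metric x) xi xi.
Proof. exact: metric_pos. Qed.

Lemma hess_L_linear x y : linear (hess_L f g x y).
Proof.
move=> a xi eta; rewrite /hess_L (hess_linear x f_C2) scalerBr scaler_sumr.
rewrite addrACA -opprD -big_split/=; congr (_ - _); apply: eq_bigr => i _.
by rewrite (hess_linear x (g_C2 i)) scalerDr !scalerA mulrC.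
Qed.

Lemma bil_hess_L x y xi eta : bil (metric x) (hess_L f g x y xi) eta =
  inner x (hess f x xi) eta - \sum_i y 0 i * inner x (hess (g i) x xi) eta.
Proof.
rewrite /hess_L bilBl bil_suml; congr (_ - _).
by apply: eq_bigr => i _; rewrite bilZl.
Qed.

Lemma H_op_linear x y : linear (H_op f g x y).
Proof.
move=> a xi eta; rewrite /H_op hess_L_linear [in RHS]scalerDr scaler_sumr [RHS]addrACA.
rewrite -big_split/=; congr (_ + _); apply: eq_bigr => i _.
rewrite scalerA -scalerDl; congr (_ *: _).
rewrite -[inner _ _ (_ + _)]/(bil (metric x) _ _) bilDr bilZr /bil /inner; ring.
Qed.

Lemma bil_H_op x y xi eta : bil (metric x) (H_op f g x y xi) eta =
  bil (metric x) (hess_L f g x y xi) eta +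
  \sum_i y 0 i / g i x * inner x (grad (g i) x) xi * inner x (grad (g i) x) eta.
Proof.
by rewrite /H_op bilDl bil_suml; congr (_ + _); apply: eq_bigr => i _; rewrite bilZl.
Qed.

Lemma H_op_symmetric x y xi eta :
  bil (metric x) (H_op f g x y xi) eta = bil (metric x) (H_op f g x y eta) xi.
Proof.
rewrite !bil_H_op !bil_hess_L (hess_symmetric x xi eta f_C2).
congr (_ - _ + _).
  by apply: eq_bigr => i _; rewrite (hess_symmetric x xi eta (g_C2 i)).
by apply: eq_bigr => i _; rewrite mulrAC.
Qed.

Section InChart.
Variables (c : chart R n M) (x : M).
Hypotheses (ac : atlas c) (cx : csrc c x).
Let u := cfwd c x.
Let K := jac c (chart_at x) u.

Lemma grad_L_jac y : grad_L f g x y = chart_grad_L c u y *m K.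
Proof.
rewrite /grad_L /chart_grad_L mulmxBl mulmx_suml -(grad_jac f_C2 ac cx).
by congr (_ - _); apply: eq_bigr => i _; rewrite -scalemxAl -(grad_jac (g_C2 i) ac cx).
Qed.

Lemma inner_grad_jac h xi : manCk 2 h ->
  inner x (grad h x) (xi *m K) = bil (gram c u) (chart_grad h c u) xi.
Proof. by move=> Ch; rewrite (grad_jac Ch ac cx) inner_jac. Qed.

Lemma inner_hess_L_jac y xi :
  inner x (hess_L f g x y (xi *m K)) (xi *m K) = hess_form_L c u y xi.
Proof.
apply: etrans (bil_hess_L x y (xi *m K) (xi *m K)) _.
rewrite (inner_hess_chart xi f_C2 ac cx); congr (_ - _); apply: eq_bigr => i _.
by rewrite (inner_hess_chart xi (g_C2 i) ac cx).
Qed.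

Lemma lambda_min_chart_le y xi :
  lambda_min (H_op f g x y) * bil (gram c u) xi xi <=
  hess_form_L c u y xi
  + \sum_i y 0 i / g i x * bil (gram c u) (chart_grad (g i) c u) xi ^+ 2.
Proof.
rewrite -inner_hess_L_jac -(inner_jac xi xi ac cx).
have := lambda_min_bil_le (xi *m K) (Defs.metric_sym x) (@metric_posdef x)
  (H_op_linear x y) (H_op_symmetric x y).
rewrite bil_H_op => /le_trans; apply; rewrite lerD2l; apply: ler_sum => i _.
by rewrite (inner_grad_jac xi (g_C2 i)) -mulrA.
Qed.

(** These are the stopping conditions in a form fit for limits: the gradient bound is squared to
    avoid roots, and the eigenvalue bound becomes a bound on the quadratic form of H in every
    direction. *)
Lemma stopping_chart (phi1 phi2 phi3 : R -> R) mu y :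
  stopping_conditions f g phi1 phi2 phi3 mu x y ->
  [/\ bil (gram c u) (chart_grad_L c u y) (chart_grad_L c u y) <= phi1 mu ^+ 2,
      forall i, `|y 0 i * g i x - mu| <= phi2 mu
    & forall xi, - phi3 mu * bil (gram c u) xi xi <= hess_form_L c u y xi
        + \sum_i y 0 i / g i x * bil (gram c u) (chart_grad (g i) c u) xi ^+ 2].
Proof.
case=> H1 H2 H3 _ _; split.
- rewrite -(inner_jac _ _ ac cx) -grad_L_jac.
  have I0 : 0 <= inner x (grad_L f g x y) (grad_L f g x y).
    rewrite -[inner _ _ _]/(bil _ _ _).
    have [->|/metric_posdef/ltW//] := eqVneq (grad_L f g x y) 0.
    by rewrite bil0r.
  by rewrite -(sqr_sqrtr I0) ler_pXn2r// nnegrE ?sqrtr_ge0// (le_trans _ H1)// sqrtr_ge0.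
- move=> i; apply: le_trans H2; rewrite /enorm -sqrtr_sqr ler_wsqrtr//.
  rewrite (bigD1 i)//= /compl_residual mul_mx_diag !mxE (mulrC (g i x)).
  by rewrite lerDl sumr_ge0// => j _; exact: sqr_ge0.
- move=> xi; apply: le_trans (lambda_min_chart_le y xi); rewrite ler_wpM2r//.
  have [->|xi0] := eqVneq xi 0; first by rewrite bil0r.
  by apply/ltW/gram_gt0 => //; exact: cfwd_tgt.
Qed.

End InChart.

End LagrangianInChart.

(** * Limit points of the outer iteration *)

Section LimitPoint.
Context {R : realType} {n m : nat} {M : riemannianManifold R n}.
Variables (f : M -> R) (g : 'I_m -> M -> R).
Hypotheses (f_C2 : manCk 2 f) (g_C2 : forall i, manCk 2 (g i)).
Variable (xs : M).
Hypothesis licq : active_grads_free g xs.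
Let c := chart_at xs.
Let u0 := cfwd c xs.

Let ac : atlas c. Proof. exact: chart_at_atlas. Qed.
Let cu0 : ctgt c u0. Proof. by apply: cfwd_tgt; exact: chart_at_src. Qed.
Let gram0 xi eta : inner xs xi eta = bil (gram c u0) xi eta.
Proof. by rewrite gram_fwd. Qed.

(** By complementarity the difference of two multipliers is supported on the active set, and it
    annihilates the gradients there. *)
Lemma KKT_unique y y' : is_KKT f g xs y -> is_KKT f g xs y' -> y = y'.
Proof.
move=> [L1 K1] [L2 K2]; apply/rowP => i; apply/eqP; rewrite -subr_eq0; apply/eqP.
have inact z j : is_KKT f g xs z -> ~~ active g xs j -> z 0 j = 0.
  move=> [_ /(_ j)[_ _ /eqP]]; rewrite mulf_eq0 => /orP[/eqP//|gj].
  by rewrite /active gj.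
have [ai|nai] := boolP (active g xs i); last first.
  by rewrite !(inact _ i)// ?subr0//; split.
apply: (licq (a := fun j => y 0 j - y' 0 j)) ai.
have -> : \sum_(j | active g xs j) (y 0 j - y' 0 j) *: grad (g j) xs =
    \sum_j (y 0 j - y' 0 j) *: grad (g j) xs.
  rewrite [RHS](bigID (active g xs))/= [X in _ = _ + X]big1 ?addr0// => j nj.
  by rewrite !(inact _ j)// ?subr0 ?scale0r//; split.
under eq_bigr do rewrite scalerBl.
rewrite sumrB; move: L1 L2; rewrite /grad_L => /subr0_eq <- /subr0_eq <-.
exact: subrr.
Qed.

(* The identity rows at inactive i make this a square system for the whole
   multiplier vector. *)
Definition active_gram (u : 'rV[R]_n) : 'M[R]_m :=
  \matrix_(i, j) if active g xs i
    then bil (gram c u) (chart_grad (g j) c u) (chart_grad (g i) c u)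
    else (i == j)%:R.

(** A kernel vector vanishes at inactive indices through the identity rows. The combination of
    gradients that it defines is orthogonal to each active gradient, hence to itself, hence zero;
    linear independence finishes. *)
Lemma active_gram_unit : active_gram u0 \in unitmx.
Proof.
rewrite -unitmx_tr -row_free_unit -kermx_eq0; apply/eqP/row_matrixP => k.
rewrite row0; set v := row k _.
have vN : v *m (active_gram u0)^T = 0 by rewrite /v -row_mul mulmx_ker row0.
move: v vN => v vN.
have vi i : \sum_j v 0 j * active_gram u0 i j = 0.
  transitivity ((v *m (active_gram u0)^T) 0 i); last by rewrite vN mxE.
  rewrite [RHS]mxE.
  by apply: eq_bigr => j _; rewrite [in RHS]mxE.
have v0 i : ~~ active g xs i -> v 0 i = 0.
  move=> nai; have := vi i; rewrite (bigD1 i)//= big1 => [|j ji].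
    by rewrite addr0 mxE (negbTE nai) eqxx mulr1.
  by rewrite mxE (negbTE nai) eq_sym (negbTE ji) mulr0.
have E : \sum_(j | active g xs j) v 0 j *: grad (g j) xs =
    \sum_j v 0 j *: chart_grad (g j) c u0.
  rewrite [RHS](bigID (active g xs))/= [X in _ = _ + X]big1 ?addr0// => j nj.
  by rewrite v0// scale0r.
have w0 : \sum_j v 0 j *: chart_grad (g j) c u0 = 0.
  set w := \sum_j _; apply/eqP/negPn/negP => /(gram_gt0 ac cu0).
  suff -> : bil (gram c u0) w w = 0 by rewrite ltxx.
  rewrite {2}/w bil_sumr big1// => i _; rewrite bilZr.
  have [ai|/v0->] := boolP (active g xs i); last by rewrite mul0r.
  rewrite /w bil_suml (_ : \sum__ _ = 0) ?mulr0// -[RHS](vi i).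
  by apply: eq_bigr => j _; rewrite bilZl mxE ai.
apply/rowP => i; rewrite [RHS]mxE.
have [ai|/v0//] := boolP (active g xs i).
by apply: (licq (a := fun j => v 0 j)) ai; rewrite E.
Qed.

Lemma mcvg_active_gram (u : nat -> 'rV[R]_n) : u @ \oo --> u0 ->
  mcvg (fun p => active_gram (u p)) (active_gram u0).
Proof.
move=> uu0 i j.
have -> : (fun p => active_gram (u p) i j) = fun p => if active g xs i
    then bil (gram c (u p)) (chart_grad (g j) c (u p)) (chart_grad (g i) c (u p))
    else (i == j)%:R by apply/funext => p; rewrite mxE.
rewrite [X in _ --> X]mxE; case: (active g xs i); last exact: cvg_cst.
have Xj := mcvg_chart_grad ac cu0 uu0 (g_C2 j).
have Xi := mcvg_chart_grad ac cu0 uu0 (g_C2 i).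
exact: (cvg_bil (mcvg_gram ac cu0 uu0) Xj Xi).
Qed.

(** * Limits along a sequence inside the chart, with indices already shifted *)

Section Sequence.
Variables (phi1 phi2 phi3 : R -> R).
Hypotheses (phi1_forcing : forcing_function phi1)
  (phi2_forcing : forcing_function phi2) (phi3_forcing : forcing_function phi3).
Variables (z : nat -> M) (lam : nat -> 'rV[R]_m) (nu : nat -> R).
Hypotheses (cz : forall p, csrc c (z p)) (z_to_xs : z @ \oo --> xs).
Hypotheses (nu_gt0 : forall p, 0 < nu p) (nu_to0 : nu @ \oo --> (0 : R)).
Hypothesis outer : forall p,
  stopping_conditions f g phi1 phi2 phi3 (nu p) (z p) (lam p).
Hypothesis xs_feasible : feasible g xs.
Let u p := cfwd c (z p).
Hypothesis active_gram_u : forall p, active_gram (u p) \in unitmx.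
Let resid p := chart_grad_L f g c (u p) (lam p).

Let cu p : ctgt c (u p). Proof. exact: cfwd_tgt. Qed.
Let uu0 : u @ \oo --> u0.
Proof. exact: cvg_comp z_to_xs (cfwd_cont (chart_at_src xs)). Qed.
Let G_cvg := mcvg_gram ac cu0 uu0.
Let Xf_cvg := mcvg_chart_grad ac cu0 uu0 f_C2.
Let Xg_cvg i := mcvg_chart_grad ac cu0 uu0 (g_C2 i).

Lemma gz_cvg i : (fun p => g i (z p)) @ \oo --> g i xs.
Proof.
have H := cvg_chart_fun ac cu0 uu0 (g_C2 i).
rewrite cfwdK in H; last exact: chart_at_src.
by apply: (cvg_eqfun H) => p; rewrite cfwdK.
Qed.

Lemma resid_sqr_cvg0 :
  (fun p => bil (gram c (u p)) (resid p) (resid p)) @ \oo --> (0 : R).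
Proof.
have p0 := forcing_cvg0 phi1_forcing nu_gt0 nu_to0.
apply: (cvg0_le _ (cvg0M p0 p0)) => p; rewrite -expr2.
have [H _ _] := stopping_chart f_C2 g_C2 ac (cz p) (outer p).
rewrite ger0_norm//; have [->|/(gram_gt0 ac (cu p))/ltW//] := eqVneq (resid p) 0.
by rewrite bil0r.
Qed.

(** Cauchy-Schwarz is used in the moving Gram matrix at [u p], where the residual is small; the
    squared norm of the constraint gradient converges. *)
Lemma resid_bil_cvg0 i :
  (fun p => bil (gram c (u p)) (resid p) (chart_grad (g i) c (u p))) @ \oo --> (0 : R).
Proof.
have H := cvg0M resid_sqr_cvg0 (cvg_bil G_cvg (@Xg_cvg i) (@Xg_cvg i)).
apply: (cvg0_sqr_le _ H) => p.
by apply: bil_sqr_le; [exact: gram_sym|move=> w; exact: gram_gt0].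
Qed.

Lemma lam_g_cvg0 i : (fun p => lam p 0 i * g i (z p)) @ \oo --> (0 : R).
Proof.
have p0 := forcing_cvg0 phi2_forcing nu_gt0 nu_to0.
have H : (fun p => lam p 0 i * g i (z p) - nu p) @ \oo --> (0 : R).
  apply: (cvg0_le _ p0) => p.
  by have [_ /(_ i)] := stopping_chart f_C2 g_C2 ac (cz p) (outer p).
have H' : (fun p => lam p 0 i * g i (z p) - nu p + nu p) @ \oo --> (0 : R).
  by rewrite -[X in _ --> X](addr0 (0 : R)); exact: cvgD H nu_to0.
by apply: (cvg_eqfun H') => p; exact: subrK.
Qed.

Lemma inactive_gt0 i : ~~ active g xs i -> 0 < g i xs.
Proof. by rewrite lt_neqAle eq_sym => ->; exact: xs_feasible. Qed.

Lemma lam_inactive_cvg0 i : ~~ active g xs i -> (fun p => lam p 0 i) @ \oo --> (0 : R).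
Proof.
move=> /inactive_gt0 gi0.
have H := cvg_div0 (@lam_g_cvg0 i) (@gz_cvg i) (lt0r_neq0 gi0).
apply: (cvg_eqfun H) => p.
by have [_ _ _ /(_ i) gp _] := outer p; rewrite mulfK// gt_eqF.
Qed.

(** Pairing grad f - resid = sum_j lam_j grad g_j with the active gradients gives the active rows of
    a linear system for [lam p]. On the identity rows the right-hand side is the multiplier itself,
    already known to tend to 0. *)
Lemma multipliers_cvg : exists ys, mcvg lam ys.
Proof.
pose b p : 'cV[R]_m := \col_i if active g xs i
  then bil (gram c (u p)) (chart_grad f c (u p) - resid p) (chart_grad (g i) c (u p))
  else lam p 0 i.
pose b0 : 'cV[R]_m := \col_i if active g xs i
  then bil (gram c u0) (chart_grad f c u0) (chart_grad (g i) c u0) else 0.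
have bb0 : mcvg b b0.
  move=> i j; rewrite mxE; under eq_fun do rewrite mxE.
  case: ifPn => [_|nai]; last exact: lam_inactive_cvg0.
  have H : (fun p => bil (gram c (u p)) (chart_grad f c (u p)) (chart_grad (g i) c (u p))
      - bil (gram c (u p)) (resid p) (chart_grad (g i) c (u p))) @ \oo -->
      bil (gram c u0) (chart_grad f c u0) (chart_grad (g i) c u0).
    rewrite -[X in _ --> X]subr0.
    exact: cvgB (cvg_bil G_cvg Xf_cvg (@Xg_cvg i)) (@resid_bil_cvg0 i).
  by apply: (cvg_eqfun H) => p; rewrite bilBl.
exists (invmx (active_gram u0) *m b0)^T.
have := mcvg_invmxM (mcvg_active_gram uu0) active_gram_unit active_gram_u bb0.
move=> /mcvg_tr; suff -> : (fun k => (invmx (active_gram (u k)) *m b k)^T) = lam by [].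
apply/funext => p.
suff -> : b p = active_gram (u p) *m (lam p)^T by rewrite mulKmx// trmxK.
apply/colP => i; rewrite [LHS]mxE [RHS]mxE.
case: ifPn => [ai|nai]; last first.
  rewrite (bigD1 i)//= big1 ?addr0 => [|j ji]; rewrite !mxE (negbTE nai).
    by rewrite eqxx mul1r.
  by rewrite eq_sym (negbTE ji) mul0r.
rewrite /resid /chart_grad_L subKr bil_suml; apply: eq_bigr => j _.
by rewrite bilZl !mxE ai mulrC.
Qed.

Variable (ys : 'rV[R]_m).
Hypothesis lam_cvg : mcvg lam ys.

Lemma KKT_limit : is_KKT f g xs ys.
Proof.
have lam_gt0 p i : 0 < lam p 0 i by have [_ _ _ _] := outer p.
have lc i : (fun p => lam p 0 i) @ \oo --> ys 0 i by exact: lam_cvg.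
split; last first.
  move=> i; split; [|exact: xs_feasible|].
    by apply: (cvg_lbound _ (lc i)) => p; exact: ltW.
  exact: cvg_uniq (cvgM (lc i) (@gz_cvg i)) (@lam_g_cvg0 i).
pose r0 := chart_grad_L f g c u0 ys.
have rr0 : mcvg resid r0.
  apply: mcvgB; first exact: Xf_cvg.
  by apply: mcvg_sum => i; apply: mcvgZ; [exact: lam_cvg|exact: Xg_cvg].
have r00 := cvg_uniq (cvg_bil G_cvg rr0 rr0) resid_sqr_cvg0.
(* [grad] at [xs] is by definition read in [c], so [grad_L f g xs ys] is convertible to [r0]. *)
suff : r0 = 0 by [].
by apply/eqP/negPn/negP => /(gram_gt0 ac cu0); rewrite r00 ltxx.
Qed.

(* Tangent directions at xs are corrected along the gradients to directions xi_p
   at z p that are orthogonal to the active gradients, so that the barrier term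
   of H contributes nothing for active constraints. *)
Lemma hess_L_limit_ge0 xi :
  (forall i, active g xs i -> inner xs (grad (g i) xs) xi = 0) ->
  0 <= inner xs (hess_L f g xs ys xi) xi.
Proof.
move=> xi_tan.
(* [d p] measures how far [xi] is from being tangent at [z p]. *)
pose d p : 'cV[R]_m := \col_i if active g xs i
  then bil (gram c (u p)) xi (chart_grad (g i) c (u p)) else 0.
have d0 : mcvg d 0.
  move=> i j; rewrite mxE; have [ai|nai] := boolP (active g xs i); last first.
    by apply: (cvg_eqfun (cvg_cst 0)) => p; rewrite mxE (negbTE nai).
  have E : bil (gram c u0) xi (chart_grad (g i) c u0) = 0.
    apply: etrans (bilC _ _ (gram_sym ac cu0)) _.
    by apply: etrans (esym (gram0 _ _)) _; exact: xi_tan.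
  have H : (fun p => bil (gram c (u p)) xi (chart_grad (g i) c (u p))) @ \oo --> (0 : R).
    by rewrite -[X in _ --> X]E; exact: cvg_bil G_cvg (@mcvg_cst R 1 n xi) (@Xg_cvg i).
  by apply: (cvg_eqfun H) => p; rewrite mxE ai.
(* The coefficients solve the Gram system for [d p]; they vanish at inactive indices, so only active
   gradients enter the correction. *)
pose a p := invmx (active_gram (u p)) *m d p.
have a0 : mcvg a 0.
  rewrite -[X in mcvg a X](mulmx0 _ (invmx (active_gram u0))).
  exact: mcvg_invmxM (mcvg_active_gram uu0) active_gram_unit active_gram_u d0.
pose xip p := xi - \sum_j a p j 0 *: chart_grad (g j) c (u p).
have xi_cvg : mcvg xip xi.
  have E : \sum_j (0 : 'cV[R]_m) j 0 *: chart_grad (g j) c u0 = 0.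
    by apply: big1 => j _; rewrite mxE scale0r.
  have H : mcvg (fun p => \sum_j a p j 0 *: chart_grad (g j) c (u p)) 0.
    rewrite -[X in mcvg _ X]E.
    by apply: mcvg_sum => j; apply: mcvgZ; [exact: a0|exact: Xg_cvg].
  rewrite -[X in mcvg xip X]subr0.
  exact: mcvgB (@mcvg_cst R 1 n xi) H.
have xip_tan p i : active g xs i ->
    bil (gram c (u p)) (chart_grad (g i) c (u p)) (xip p) = 0.
  move=> ai; rewrite (bilC _ _ (gram_sym ac (cu p))) /xip bilBl bil_suml.
  have : (active_gram (u p) *m a p) i 0 = d p i 0 by rewrite mulKVmx.
  rewrite [RHS]mxE ai [LHS]mxE => <-; apply/eqP; rewrite subr_eq0; apply/eqP.
  by apply: eq_bigr => j _; rewrite bilZl mxE ai mulrC.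
have xi2 := cvg_bil G_cvg xi_cvg xi_cvg.
have nphi3 : (fun p => - phi3 (nu p)) @ \oo --> (0 : R).
  rewrite -[X in _ --> X]oppr0; exact: cvgN (forcing_cvg0 phi3_forcing nu_gt0 nu_to0).
have lower := cvg0M nphi3 xi2.
have hess_cvg : (fun p => hess_form_L f g c (u p) (lam p) (xip p)) @ \oo -->
    hess_form_L f g c u0 ys xi.
  have hf := cvg_hess_form ac cu cu0 uu0 f_C2 xi_cvg.
  have hg i := cvg_hess_form ac cu cu0 uu0 (g_C2 i) xi_cvg.
  have lc i : (fun p => lam p 0 i) @ \oo --> ys 0 i by exact: lam_cvg.
  exact: cvgB hf (cvg_sumr (fun i _ => cvgM (lc i) (hg i))).
have barrier_cvg : (fun p => \sum_i lam p 0 i / g i (z p) *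
    bil (gram c (u p)) (chart_grad (g i) c (u p)) (xip p) ^+ 2) @ \oo --> (0 : R).
  have term i : (fun p => lam p 0 i / g i (z p) *
      bil (gram c (u p)) (chart_grad (g i) c (u p)) (xip p) ^+ 2) @ \oo --> (0 : R).
    (* For active [i] the quotient may diverge, but it multiplies an exact zero; for inactive [i]
       the quotient tends to 0 and the square converges. *)
    have [ai|nai] := boolP (active g xs i).
      by apply: (cvg_eqfun (cvg_cst 0)) => p; rewrite (xip_tan p i ai) expr0n mulr0.
    have b := cvg_bil G_cvg (@Xg_cvg i) xi_cvg.
    have gi0 := lt0r_neq0 (inactive_gt0 nai).
    exact: cvg0M (cvg_div0 (lam_inactive_cvg0 nai) (@gz_cvg i) gi0) (cvgM b b).
  exact: cvg0_sum term.
have upper : (fun p => hess_form_L f g c (u p) (lam p) (xip p)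
    + \sum_i lam p 0 i / g i (z p) *
      bil (gram c (u p)) (chart_grad (g i) c (u p)) (xip p) ^+ 2) @ \oo -->
    hess_form_L f g c u0 ys xi.
  rewrite -[X in _ --> X]addr0; exact: cvgD hess_cvg barrier_cvg.
have -> : inner xs (hess_L f g xs ys xi) xi = hess_form_L f g c u0 ys xi.
  rewrite -(inner_hess_L_jac f_C2 g_C2 ac (chart_at_src xs)).
  by rewrite (jac_id ac cu0) mulmx1.
apply: (cvg_le_trans _ lower upper) => p.
by have [_ _] := stopping_chart f_C2 g_C2 ac (cz p) (outer p); apply.
Qed.

End Sequence.

End LimitPoint.

(** * Passage to a tail of the subsequence and conclusion *)

Lemma cvg_infty_ge (h : nat -> nat) : (forall p, (p <= h p)%N) -> h @ \oo --> \oo.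
Proof.
move=> hp A [N _ NA]; exists N => // p /= Np; apply: NA; exact: leq_trans (hp p).
Qed.

Theorem corollary4p18 (R : realType) (n m : nat) (M : riemannianManifold R n)
  (M_connected : connected [set: M]) (M_complete : metrically_complete M)
  (f : M -> R) (g : 'I_m -> M -> R)
  (f_C2 : manCk 2 f) (g_C2 : forall i, manCk 2 (g i))
  (phi1 phi2 phi3 : R -> R)
  (phi1_forcing : forcing_function phi1)
  (phi2_forcing : forcing_function phi2)
  (phi3_forcing : forcing_function phi3)
  (x : nat -> M) (y : nat -> 'rV[R]_m) (mu : nat -> R)
  (x_interior : forall k, strictly_feasible g (x k))
  (y_pos : forall k i, 0 < y k 0 i)
  (mu_pos : forall k, 0 < mu k)
  (mu_to0 : mu @ \oo --> (0 : R))
  (outer : forall k,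
     stopping_conditions f g phi1 phi2 phi3 (mu k) (x k.+1) (y k.+1))
  (xs : M) (xs_feasible : feasible g xs)
  (xs_acc : cluster (x @ \oo) xs)
  (kn : nat -> nat) (kn_increasing : forall p q, (p < q)%N -> (kn p < kn q)%N)
  (x_to_xs : (fun p => x (kn p)) @ \oo --> xs)
  (grad_bounded : forall i, exists B : R, forall p,
     rnorm (x (kn p)) (grad (g i) (x (kn p))) <= B)
  (licq : active_grads_free g xs)
  (f_lip : locally_lipschitz_hess f xs)
  (g_lip : forall i, locally_lipschitz_hess (g i) xs)
  (sc : forall ys, is_KKT f g xs ys -> strict_complementarity g xs ys) :
  exists ys : 'rV[R]_m, unique (is_KKT f g xs) ys /\ is_SOSP f g xs ys.
Proof.
pose c := chart_at xs.
have kn_ge p : (p <= kn p)%N.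
  by elim: p => // p IHp; apply: leq_ltn_trans IHp _; exact: kn_increasing.
have ac : atlas c by exact: chart_at_atlas.
have sc0 : csrc c xs by exact: chart_at_src.
have x_near : \forall p \near \oo, csrc c (x (kn p)).
  by apply: x_to_xs; apply: open_nbhs_nbhs; split=> //; exact: csrc_open.
have u_cvg : (fun p => cfwd c (x (kn p))) @ \oo --> cfwd c xs.
  exact: cvg_comp x_to_xs (cfwd_cont sc0).
have unit_near : \forall p \near \oo, active_gram g xs (cfwd c (x (kn p))) \in unitmx.
  have d0 : \det (active_gram g xs (cfwd c xs)) != 0.
    by rewrite -unitfE -unitmxE; exact: active_gram_unit.
  have H := cvg_det (mcvg_active_gram g_C2 u_cvg).
  by apply: filterS (cvgr_neq0 _ H d0) => p; rewrite unitmxE unitfE.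
have [N _ HN] := filterI x_near unit_near.
(* Adding [N] skips the indices where the iterate leaves the chart or the Gram system is singular.
   The successor makes [kn (s p)] positive, so that this iterate is some w_(k+1), governed by mu_k
   with k its predecessor. *)
pose s p := (p + N).+1.
have s_ge p : (N <= s p)%N by rewrite /s leqW// leq_addl.
have ps p : (p < s p)%N by rewrite /s ltnS leq_addr.
have ks p : (kn (s p)).-1.+1 = kn (s p).
  by rewrite prednK// (leq_ltn_trans _ (leq_trans (ps p) (kn_ge _))).
pose z p := x (kn (s p)); pose lam p := y (kn (s p)); pose nu p := mu (kn (s p)).-1.
have s_oo : s @ \oo --> \oo by apply: cvg_infty_ge => p; exact/ltnW/ps.
have z_cvg : z @ \oo --> xs by exact: cvg_comp s_oo x_to_xs.
have nu_cvg : nu @ \oo --> (0 : R).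
  apply: cvg_comp mu_to0; apply: cvg_infty_ge => p.
  by rewrite -ltnS ks (leq_trans (ps p)).
have stop p : stopping_conditions f g phi1 phi2 phi3 (nu p) (z p) (lam p).
  by have := outer (kn (s p)).-1; rewrite ks.
have cz p : csrc c (z p) by have [] := HN _ (s_ge p).
have uz p : active_gram g xs (cfwd c (z p)) \in unitmx by have [] := HN _ (s_ge p).
have nu_gt0 p : 0 < nu p by exact: mu_pos.
have [ys lam_cvg] := multipliers_cvg f_C2 g_C2 licq phi1_forcing phi2_forcing
  cz z_cvg nu_gt0 nu_cvg stop xs_feasible uz.
have KKT : is_KKT f g xs ys.
  exact: (KKT_limit f_C2 g_C2 phi1_forcing phi2_forcing cz z_cvg nu_gt0 nu_cvg stop).
exists ys; split; first by split=> // y' KKT'; exact: KKT_unique KKT KKT'.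
split=> // xi xi_crit.
apply: (hess_L_limit_ge0 f_C2 g_C2 licq phi2_forcing phi3_forcing cz z_cvg nu_gt0
  nu_cvg stop xs_feasible uz lam_cvg) => i ai.
have [H _] := xi_crit i ai; apply: H.
(* At an active index strict complementarity excludes a zero multiplier, so the critical cone
   imposes the equality. *)
have [ysi0 _ _] := KKT.2 i; rewrite lt_neqAle ysi0 andbT eq_sym.
by have := sc ys KKT i; move: ai; rewrite /active => ->; case: eqP.
Qed.
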